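(* Let $m=2$, let $n$ be a positive integer and let $\sigma_1,\dots,\sigma_n$ be distinct positive constants. Fix $\hat x\in\mathbb{S}^1$ with $\hat x\neq d$, and let $\tau$ be a real constant with $\tau\notin\left\{\frac{\ell\pi}{k(1-\hat x\cdot d)}:\ell\in\mathbb{Z}\right\}$. For $t>0$ let $t_j=\sigma_jt+c_j$ and $\tilde t_j=t_j+\tau$ ($j=1,\dots,n$), where $c_1\geq0$ is arbitrarily fixed and, for $j\ge2$, $c_j\in\left[0,\frac{2\pi}{k(1-\hat x\cdot d)}\right)$ is such that $t_j-t_1\in\left\{\frac{2\ell\pi}{k(1-\hat x\cdot d)}:\ell\in\mathbb{Z}\right\}$ for each $t$. Let $Q_1$ and $Q_2$ be the $n\times n$ matrices with $(i,j)$ entries $t_i^{-(j-1)}$ and $\tilde t_i^{-(j-1)}$, respectively, and let $$E=\begin{pmatrix}e^{it_1k(1-\hat x\cdot d)}&e^{it_1k(\hat x\cdot d-1)}\\ e^{i(t_1+\tau)k(1-\hat x\cdot d)}&e^{i(t_1+\tau)k(\hat x\cdot d-1)}\end{pmatrix}.$$ Suppose that from the phaseless data $\{|u(x,d)|:|x|=t_1,\dots,t_{n-1},\tilde t_1,\dots,\tilde t_{n-1}\}$ one has obtained quantities $f_\ell^{(n-1)}(\hat x)$ (depending on $t$) with $$f_\ell^{(n-1)}(\hat x)=f_\ell(\hat x)+O(t^{\ell-n}),\quad t\to\infty,\quad\ell=1,2,\dots,n-1.$$ Define successively (empty sums are zero): 1. $h_j^{(n-1)}(\hat x)=\sum_{\ell=1}^{j}f_\ell^{(n-1)}(\hat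 x)\overline{f_{j-\ell+1}^{(n-1)}(\hat x)}$ for $j=1,\dots,n-1$, and $v^{(n-1)}(x,d):=|x|^{1/2}[|u(x,d)|^2-1]-\sum_{j=1}^{n-1}\frac{h_j^{(n-1)}(\hat x)}{|x|^{j-1/2}}$; 2. $(F_{1,H},\dots,F_{n,H})^\top=Q_1^{-1}\left(v^{(n-1)}(t_1\hat x,d),\dots,v^{(n-1)}(t_n\hat x,d)\right)^\top$ and $(\widetilde F_{1,H},\dots,\widetilde F_{n,H})^\top=Q_2^{-1}\left(v^{(n-1)}(\tilde t_1\hat x,d),\dots,v^{(n-1)}(\tilde t_n\hat x,d)\right)^\top$; 3. $\left(\tilde f_j^{(n)}(\hat x),\overline{\tilde f_j^{(n)}(\hat x)}\right)^\top=E^{-1}\left(F_{j,H},\widetilde F_{j,H}\right)^\top$ for $j=1,\dots,n$; 4. $\tilde h_j^{(n)}(\hat x)=\sum_{\ell=1}^{j}\tilde f_\ell^{(n)}(\hat x)\overline{\tilde f_{j-\ell+1}^{(n)}(\hat x)}$ for $j=1,\dots,n$, and $v^{(n)}(x,d):=|x|^{1/2}[|u(x,d)|^2-1]-\sum_{j=1}^{n}\frac{\tilde h_j^{(n)}(\hat x)}{|x|^{j-1/2}}$; 5. $(F'_{1,H},\dots,F'_{n,H})^\top=Q_1^{-1}\left(v^{(n)}(t_1\hat x,d),\dots,v^{(n)}(t_n\hat x,d)\right)^\top$ and $(\widetilde F'_{1,H},\dots,\widetilde F'_{n,H})^\top=Q_2^{-1}\left(v^{(n)}(\tilde t_1\hat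 x,d),\dots,v^{(n)}(\tilde t_n\hat x,d)\right)^\top$. Then, for $j=1,2,\dots,n$, $$\left(f_j(\hat x),\overline{f_j(\hat x)}\right)^\top=E^{-1}\begin{pmatrix}F'_{j,H}\\ \widetilde F'_{j,H}\end{pmatrix}+O\left(\frac1{t^{n+1-j}}\right)\quad\text{as }t\to\infty.$$
   Context: Let $m=2$, $k>0$, and let $D\subset\mathbb{R}^2$ be a bounded domain with boundary $\partial D$ of class $C^{3,\alpha}$ which is the open complement of an unbounded domain. $\nu$ is the unit exterior normal on $\partial D$. Fix $d\in\mathbb{S}^1$. The incident field is $u^i(x,d)=e^{ikx\cdot d}$; the total field $u=u^i+u^s$ satisfies $\Delta^2u-k^4u=0$ in $\mathbb{R}^2\setminus\overline D$, $\mathscr{B}u=(0,0)$ on $\partial D$ with $\mathscr{B}u$ one of $(u,\partial_\nu u)$, $(u,\Delta u)$, $(\Delta u,\partial_\nu\Delta u)$, $(u,\partial_\nu\Delta u)$, $(\partial_\nu u,\Delta u)$, $(\partial_\nu u,\partial_\nu\Delta u)$, and $\lim_{r\to\infty}r^{1/2}\left(\partial_ru^s-iku^s\right)=0$, $r=|x|$, uniformly in all directions. Set $u_H:=\frac12(u^s-\Delta u^s/k^2)$ and $u_M:=\frac12(u^s+\Delta u^s/k^2)$, so $u^s=u_H+u_M$, $\Delta u_H+k^2u_H=0$, $\Delta u_M-k^2u_M=0$ in $\mathbb{R}^2\setminus\overline D$, and both satisfy the same radiation condition. The functions $f_j$ on $\mathbb{S}^1$ are the coefficients of the Atkinson-type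 expansion of $u_H=u_H(\cdot,d)$: for every $N\in\mathbb{N}$, $$u_H(x)=\frac{e^{ik|x|}}{|x|^{1/2}}\left\{\sum_{j=1}^N\frac{f_j(\hat x)}{|x|^{j-1}}+O\left(\frac1{|x|^N}\right)\right\},\quad|x|\to\infty,\ \hat x=x/|x|;$$ in particular $f_1=u_H^\infty$ is the far-field pattern of $u_H$. *)

(* Defs.v *)
From HB Require Import structures.
From mathcomp Require Import all_boot all_order all_algebra.
From mathcomp Require Import complex.
From mathcomp Require Import all_classical all_reals all_analysis.

Set Implicit Arguments.
Unset Strict Implicit.
Unset Printing Implicit Defensive.

Import Order.TTheory GRing.Theory Num.Theory.
Import numFieldNormedType.Exports.

Local Open Scope classical_set_scope.
Local Open Scope ring_scope.
Local Open Scope complex_scope.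

Section Plane.
Context {R : realType}.
Implicit Types (x y p d v e : 'rV[R]_2) (A D : set 'rV[R]_2).

Definition dot x y : R := \sum_(i < 2) x 0 i * y 0 i.

(* The norm of the library on 'rV[R]_2 is the sup norm, hence this one; the
   two define the same topology and the same bounded sets. *)
Definition enorm x : R := Num.sqrt (dot x x).

Definition cabs (z : R[i]) : R := ComplexField.Normc.normc z.

Definition cis (a : R) : R[i] := cos a +i* sin a.

Definition perp e : 'rV[R]_2 := \row_i (if i == 0 then - e 0 1 else e 0 0).

Definition plane_domain A := [/\ open A, connected A & A !=set0].

Definition exterior D : set 'rV[R]_2 := ~` closure D.

Definition bdry D : set 'rV[R]_2 := closure D `&` closure (~` D).

Definition complement_of_unbounded_domain D :=
  exists2 G, plane_domain G /\ ~ bounded_set G & D = (~` G)°.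

(* In the orthonormal frame (e, perp e) centred at p, the part of D in the
   disc of radius r is the part of the disc lying below the graph of g. *)
Definition below_graph D p e (r : R) (g : R -> R) :=
  forall x, enorm (x - p) < r ->
    (D x <-> dot (x - p) (perp e) < g (dot (x - p) e)).

Definition C3_holder (alpha r : R) (g : R -> R) :=
  (forall (i : nat) (s : R), (i < 3)%N -> `|s| < r -> derivable (derive1n i g) s 1) /\
  exists M : R, forall s s' : R, `|s| < r -> `|s'| < r ->
    `|derive1n 3 g s - derive1n 3 g s'| <= M * `|s - s'| `^ alpha.

Definition C3_holder_boundary (alpha : R) D :=
  forall p, bdry D p -> exists e r g,
    [/\ enorm e = 1, 0 < r, C3_holder alpha r g & below_graph D p e r g].

Definition unit_exterior_normal D (nu : 'rV[R]_2 -> 'rV[R]_2) :=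
  forall p e (r : R) (g : R -> R), bdry D p ->
    enorm e = 1 -> 0 < r -> derivable g 0 1 -> below_graph D p e r g ->
    nu p = (Num.sqrt (1 + derive1 g 0 ^+ 2))^-1 *: (perp e - derive1 g 0 *: e).

End Plane.

Section ComplexFunctions.
Context {R : realType}.
Implicit Types (x p v : 'rV[R]_2) (w : 'rV[R]_2 -> R[i]) (D : set 'rV[R]_2).

(* The library has no normed R-module structure on R[i]: derivatives and
   continuity of complex-valued functions are taken componentwise. *)
Definition re_fun w x : R := complex.Re (w x).
Definition im_fun w x : R := complex.Im (w x).

Definition cderive v w x : R[i] := ('D_v (re_fun w) x) +i* ('D_v (im_fun w) x).

Definition unit_vec (i : 'I_2) : 'rV[R]_2 := delta_mx 0 i.

Definition laplacian w x : R[i] :=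
  \sum_(i < 2) cderive (unit_vec i) (cderive (unit_vec i) w) x.

Fixpoint Cn_on (A : set 'rV[R]_2) (n : nat) (g : 'rV[R]_2 -> R) : Prop :=
  (forall x, A x -> {for x, continuous g}) /\
  (if n is m.+1 then
     forall i : 'I_2, (forall x, A x -> derivable g x (unit_vec i)) /\
       Cn_on A m (fun x => 'D_(unit_vec i) g x)
   else True).

Definition cCn_on A n w := Cn_on A n (re_fun w) /\ Cn_on A n (im_fun w).

End ComplexFunctions.

Section Scattering.
Context {R : realType}.
Implicit Types (x p v d xh : 'rV[R]_2) (D : set 'rV[R]_2).
Implicit Types (u us w : 'rV[R]_2 -> R[i]).

Definition incident_field (k : R) d x : R[i] := cis (k * dot x d).

Definition total_field (k : R) d us x : R[i] := incident_field k d x + us x.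

Inductive boundary_op := Trace | NormalDer | LaplaceTrace | LaplaceNormalDer.

Definition boundary_op_eval (b : boundary_op) v w x : R[i] :=
  match b with
  | Trace => w x
  | NormalDer => cderive v w x
  | LaplaceTrace => laplacian w x
  | LaplaceNormalDer => cderive v (laplacian w) x
  end.

(* Boundary values are limits from the exterior domain. *)
Definition vanishes_on_bdry D (nu : 'rV[R]_2 -> 'rV[R]_2) (b : boundary_op) w :=
  forall p, bdry D p ->
    cabs (boundary_op_eval b (nu p) w x) @[x --> within (exterior D) (nbhs p)]
      --> (0 : R).

Inductive boundary_condition := BC_01 | BC_02 | BC_23 | BC_03 | BC_12 | BC_13.

Definition boundary_pair (B : boundary_condition) : boundary_op * boundary_op :=
  match B with
  | BC_01 => (Trace, NormalDer)
  | BC_02 => (Trace, LaplaceTrace)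
  | BC_23 => (LaplaceTrace, LaplaceNormalDer)
  | BC_03 => (Trace, LaplaceNormalDer)
  | BC_12 => (NormalDer, LaplaceTrace)
  | BC_13 => (NormalDer, LaplaceNormalDer)
  end.

Definition radiating (k : R) w :=
  forall eps : R, 0 < eps -> \forall r \near +oo,
    forall xh, enorm xh = 1 ->
      Num.sqrt r * cabs (cderive xh w (r *: xh) - (0 +i* k) * w (r *: xh)) < eps.

Definition biharmonic_scattering (k : R) d D (nu : 'rV[R]_2 -> 'rV[R]_2)
    (B : boundary_condition) us :=
  let u := total_field k d us in
  [/\ cCn_on (exterior D) 4 us,
      forall x, exterior D x -> laplacian (laplacian u) x - (k ^+ 4)%:C * u x = 0,
      vanishes_on_bdry D nu (boundary_pair B).1 u,
      vanishes_on_bdry D nu (boundary_pair B).2 u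
    & radiating k us].

Definition helmholtz_part (k : R) us x : R[i] :=
  (2^-1 : R)%:C * (us x - laplacian us x / (k ^+ 2)%:C).

(* The coefficients f j are indexed from j = 1, and the remainder is uniform
   in the direction xh. *)
Definition atkinson_expansion (k : R) w (f : nat -> 'rV[R]_2 -> R[i]) :=
  forall N : nat, (0 < N)%N -> exists M : R, \forall r \near +oo,
    forall xh, enorm xh = 1 ->
      cabs (w (r *: xh) / (cis (k * r) / (Num.sqrt r)%:C)
            - \sum_(1 <= j < N.+1) f j xh / (r ^+ (j - 1))%:C) <= M / r ^+ N.

End Scattering.

Section PhaseRetrieval.
Context {R : realType}.
Implicit Types (d xh x : 'rV[R]_2) (u : 'rV[R]_2 -> R[i]).

Definition bigO_pinfty (g : R -> R[i]) (rate : R -> R) :=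
  exists M : R, \forall t \near +oo, cabs (g t) <= M * `|rate t|.

Definition col2 (a b : R[i]) : 'cV[R[i]]_2 := \col_i (if i == 0 then a else b).

Definition phase_rate (k : R) xh d : R := k * (1 - dot xh d).

Definition phase_mx (kappa tau t1 : R) : 'M[R[i]]_2 :=
  \matrix_(i, j)
    let s := if i == 0 then t1 else t1 + tau in
    cis (if j == 0 then s * kappa else s * - kappa).

(* From here on, sequences such as t, h and f are indexed from 1, whereas
   matrix indices in 'I_n start at 0. *)
Definition Q_mx (n : nat) (t : nat -> R) : 'M[R[i]]_n :=
  \matrix_(i < n, j < n) ((t i.+1) ^- j)%:C.

Definition entry (n : nat) (F : 'cV[R[i]]_n) (j : nat) : R[i] :=
  if insub j.-1 is Some i then F i 0 else 0.

Definition Q_solve (n : nat) (t : nat -> R) (v : 'rV[R]_2 -> R[i]) xh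
    (j : nat) : R[i] :=
  entry (invmx (Q_mx n t) *m \col_(i < n) v (t i.+1 *: xh)) j.

Definition self_conv (f : nat -> R[i]) (j : nat) : R[i] :=
  \sum_(1 <= l < j.+1) f l * (f (j - l + 1)%N)^*%C.

Definition corrected_data u (N : nat) (h : nat -> R[i]) x : R[i] :=
  (Num.sqrt (enorm x) * (cabs (u x) ^+ 2 - 1))%:C
  - \sum_(1 <= j < N.+1) h j / (enorm x `^ (j%:R - 2^-1))%:C.

End PhaseRetrieval.

(* Main.v *)
Require Import Defs.
From HB Require Import structures.
From mathcomp Require Import all_boot all_order all_algebra.
From mathcomp Require Import complex ring lra.
From mathcomp Require Import all_classical all_reals all_analysis.

Set Implicit Arguments.
Unset Strict Implicit.
Unset Printing Implicit Defensive.

Import Order.TTheory GRing.Theory Num.Theory.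
Import numFieldNormedType.Exports.

Local Open Scope classical_set_scope.
Local Open Scope ring_scope.
Local Open Scope complex_scope.

(** The Helmholtz part u_H of the scattered field has an expansion in powers of
    1/r with prefactor e^{ikr} / r^{1/2}, whereas the remaining part u_M decays
    faster than every power of r. Hence, with kappa = k (1 - xh.d), the data
      r^{1/2} (|u(r xh)|^2 - 1)
    equal, up to O(r^-n),
      sum_j (e^{i kappa r} f_j + e^{-i kappa r} conj f_j) r^-(j-1)
      + sum_j h_j r^(1/2-j),     h_j = sum_l f_l conj f_(j-l+1)
    ([scattered_field_expansion], [data_expansion]).

    The decay of u_M is derived from the radiation condition for us alone. That
    condition bounds the radial derivative of e^{-ikr} us, so us grows at most
    linearly ([radiating_linear_growth]); u_H is bounded by its expansion, so
    u_M grows at most linearly as well. As u_M solves the modified Helmholtz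
    equation, comparison with the barrier B |x|^-2N + eps |x|^2, where eps tends
    to 0, shows that it is O(|x|^-2N) for every N ([modified_helmholtz_decay]).

    The radii t_i are synchronised modulo 2 pi / kappa, so that the oscillating
    factors take one common value at t_1, ..., t_n and another one at the shifted
    radii. Inverting the Vandermonde-like matrices costs a factor t^(j-1) in the
    j-th coefficient ([Q_solve_error]), and inverting E costs nothing, since
    det E = -2i sin(kappa tau) is a nonzero constant ([phase_mx_inv]). A pass
    whose corrected data have error O(t^a) therefore yields f_j with error
    O(t^(a+j-1)) ([retrieval_error]). With the given approximations of order
    n - 1 the first pass has a = 1/2 - n, because of the neglected term
    h_n r^(1/2-n); the coefficients it yields make a = -n possible in the second
    pass, which is the claim. *)

(** * Modulus and power growth of complex-valued functions *)

Section Modulus.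
Context {R : realType}.
Implicit Types (z w : R[i]) (x : R).

Lemma cabs_ge0 z : 0 <= cabs z.
Proof. by case: z => a b; exact: sqrtr_ge0. Qed.

Lemma cabs0 : cabs (0 : R[i]) = 0.
Proof. exact: ComplexField.Normc.normc0. Qed.

Lemma cabsM z w : cabs (z * w) = cabs z * cabs w.
Proof. exact: ComplexField.Normc.normcM. Qed.

Lemma cabsV z : cabs z^-1 = (cabs z)^-1.
Proof. exact: ComplexField.Normc.normcV. Qed.

Lemma cabsN z : cabs (- z) = cabs z.
Proof. exact: (normcN (z : Rcomplex R)). Qed.

Lemma cabsD z w : cabs (z + w) <= cabs z + cabs w.
Proof. exact: (le_normcD (z : Rcomplex R)). Qed.

Lemma cabs_real x : cabs x%:C = `|x|.
Proof. by rewrite /cabs /= expr0n addr0 sqrtr_sqr. Qed.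

Lemma cabs_conj z : cabs z^*%C = cabs z.
Proof. by case: z => a b; rewrite /cabs /= sqrrN. Qed.

Lemma sqr_cabs z : cabs z ^+ 2 = complex.Re z ^+ 2 + complex.Im z ^+ 2.
Proof. by case: z => a b; rewrite /cabs /= sqr_sqrtr// addr_ge0// sqr_ge0. Qed.

Lemma sqr_cabsC z : (cabs z ^+ 2)%:C = z * z^*%C.
Proof.
rewrite sqr_cabs; case: z => a b; simpc; rewrite !expr2.
by congr (_ +i* _); ring.
Qed.

Lemma normr_Re_le z : `|complex.Re z| <= cabs z.
Proof.
rewrite -sqrtr_sqr; case: z => a b; rewrite /cabs /= ler_sqrt.
  by rewrite lerDl sqr_ge0.
by rewrite addr_ge0// sqr_ge0.
Qed.

Lemma normr_Im_le z : `|complex.Im z| <= cabs z.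
Proof.
rewrite -sqrtr_sqr; case: z => a b; rewrite /cabs /= ler_sqrt.
  by rewrite lerDr sqr_ge0.
by rewrite addr_ge0// sqr_ge0.
Qed.

Lemma cabs_le_ReIm z : cabs z <= `|complex.Re z| + `|complex.Im z|.
Proof.
have h : 0 <= `|complex.Re z| + `|complex.Im z| by rewrite addr_ge0.
rewrite -(@ler_pXn2r _ 2)// ?nnegrE ?cabs_ge0// sqr_cabs.
rewrite -(real_normK (num_real (complex.Re z))).
rewrite -(real_normK (num_real (complex.Im z))) sqrrD.
by rewrite -addrA lerD2l lerDr mulrn_wge0// mulr_ge0.
Qed.

Lemma cabs_cis x : cabs (cis x) = 1.
Proof. by rewrite /cabs /cis /= cos2Dsin2 sqrtr1. Qed.

Lemma cisD x y : cis (x + y) = cis x * cis y.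
Proof.
rewrite /cis; simpc; rewrite cosD sinD.
by congr (_ +i* _); rewrite addrC.
Qed.

Lemma cis_conj x : (cis x)^*%C = cis (- x).
Proof. by rewrite /cis cosN sinN. Qed.

Lemma cis0 : cis (0 : R) = 1.
Proof. by rewrite /cis cos0 sin0. Qed.

Lemma cis_neq0 x : cis x != 0.
Proof. by apply/eqP => /(congr1 cabs); rewrite cabs_cis cabs0 => /eqP; rewrite oner_eq0. Qed.

Lemma cisN x : cis (- x) = (cis x)^-1.
Proof.
apply: (mulfI (cis_neq0 x)).
by rewrite -cisD addrN cis0 divff// cis_neq0.
Qed.

Lemma cis_periodicz x (l : int) : cis (x + 2 * l%:~R * pi) = cis x.
Proof.
have nat_case (m : nat) (y : R) : cis (y + 2 * m%:R * pi) = cis y.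
  rewrite /cis (_ : 2 * m%:R * pi = pi *+ 2 *+ m); last first.
    by rewrite -[pi *+ 2]mulr_natl -[RHS]mulr_natl; ring.
  elim: m => [|m IHm] in y *; first by rewrite mulr0n addr0.
  by rewrite mulrS addrA IHm cosD2pi sinD2pi.
case: l => m; first exact: nat_case.
rewrite -[LHS](nat_case m.+1) NegzE; congr (cis _).
by rewrite mulrNz pmulrn; ring.
Qed.

End Modulus.

Lemma near_pinfty_ge {R : realType} (x : R) : \forall t \near +oo, x <= t.
Proof. by apply: nbhs_pinfty_ge; exact: num_real. Qed.

Lemma near_pinfty_gt {R : realType} (x : R) : \forall t \near +oo, x < t.
Proof. by apply: nbhs_pinfty_gt; exact: num_real. Qed.

(** [Opow g a] : the complex-valued function [g] is O(t^a) as t tends to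
    infinity, for a real exponent [a]. *)
Definition Opow {R : realType} (g : R -> R[i]) (a : R) :=
  exists M : R, \forall t \near +oo, cabs (g t) <= M * t `^ a.

Section PowerGrowth.
Context {R : realType}.
Implicit Types (g : R -> R[i]) (a b : R).

Lemma OpowP g a : Opow g a ->
  exists2 M : R, 0 <= M & \forall t \near +oo, cabs (g t) <= M * t `^ a.
Proof.
case=> M HM; exists `|M|; first by [].
near=> t; apply: (@le_trans _ _ (M * t `^ a)); first by near: t.
by rewrite ler_wpM2r ?powR_ge0 ?ler_norm.
Unshelve. all: by end_near. Qed.

Lemma bigO_pinfty_Opow g (m : nat) :
  bigO_pinfty g (fun t => t ^- m) <-> Opow g (- m%:R).
Proof.
split=> -[M HM]; exists M; near=> t.
  have t0 : 0 < t by near: t; exact: near_pinfty_gt.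
  rewrite powR_invn ?(ltW t0)// -[t ^- m]ger0_norm ?invr_ge0 ?exprn_ge0 ?(ltW t0)//.
  by near: t.
have t0 : 0 < t by near: t; exact: near_pinfty_gt.
rewrite ger0_norm ?invr_ge0 ?exprn_ge0 ?(ltW t0)//.
by rewrite -powR_invn ?(ltW t0)//; near: t.
Unshelve. all: by end_near. Qed.

Lemma Opow_near g g' a : (\forall t \near +oo, g t = g' t) -> Opow g a -> Opow g' a.
Proof.
move=> e [M HM]; exists M; near=> t.
rewrite -(_ : g t = g' t); first by near: t.
by near: t.
Unshelve. all: by end_near. Qed.

Lemma Opow_le_near g g' a : (\forall t \near +oo, cabs (g' t) <= cabs (g t)) ->
  Opow g a -> Opow g' a.
Proof.
move=> e [M HM]; exists M; near=> t.
by apply: (@le_trans _ _ (cabs (g t))); near: t.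
Unshelve. all: by end_near. Qed.

Lemma Opow_weaken g a b : a <= b -> Opow g a -> Opow g b.
Proof.
move=> ab /OpowP[M M0 HM]; exists M; near=> t.
apply: (@le_trans _ _ (M * t `^ a)); first by near: t.
have t1 : 1 <= t by near: t; exact: near_pinfty_ge.
by rewrite ler_wpM2l// ler_powR.
Unshelve. all: by end_near. Qed.

Lemma OpowD g g' a : Opow g a -> Opow g' a -> Opow (fun t => g t + g' t) a.
Proof.
move=> [M HM] [M' HM']; exists (M + M'); near=> t.
rewrite mulrDl; apply: le_trans (cabsD _ _) _.
by apply: lerD; near: t.
Unshelve. all: by end_near. Qed.

Lemma OpowN g a : Opow g a -> Opow (fun t => - g t) a.
Proof. by apply: Opow_le_near; near=> t; rewrite cabsN. Unshelve. all: by end_near. Qed.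

Lemma Opow_conj g a : Opow g a -> Opow (fun t => (g t)^*%C) a.
Proof. by apply: Opow_le_near; near=> t; rewrite cabs_conj. Unshelve. all: by end_near. Qed.

Lemma OpowM g g' a b : Opow g a -> Opow g' b -> Opow (fun t => g t * g' t) (a + b).
Proof.
move=> /OpowP[M M0 HM] /OpowP[M' M'0 HM']; exists (M * M'); near=> t.
rewrite cabsM powRD; last first.
  by apply/implyP => _; rewrite gt_eqF//; near: t; exact: near_pinfty_gt.
rewrite mulrACA; apply: ler_pM; rewrite ?cabs_ge0//; by near: t.
Unshelve. all: by end_near. Qed.

Lemma OpowM_to g g' a b c : a + b = c ->
  Opow g a -> Opow g' b -> Opow (fun t => g t * g' t) c.
Proof. by move=> <-; exact: OpowM. Qed.

Lemma Opow_cst (z : R[i]) : Opow (fun=> z) 0.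
Proof. by exists (cabs z); near=> t; rewrite powRr0 mulr1. Unshelve. all: by end_near. Qed.

Lemma Opow0 a : Opow (fun=> 0) a.
Proof. by exists 0; near=> t; rewrite cabs0 mul0r. Unshelve. all: by end_near. Qed.

Lemma Opow_cis (x : R -> R) : Opow (fun t => cis (x t)) 0.
Proof. by exists 1; near=> t; rewrite cabs_cis powRr0 mulr1. Unshelve. all: by end_near. Qed.

Lemma Opow_sum (I : Type) (r : seq I) (P : pred I) (G : I -> R -> R[i]) a :
  (forall i, P i -> Opow (G i) a) ->
  Opow (fun t => \sum_(i <- r | P i) G i t) a.
Proof.
move=> h; elim: r => [|i r IHr].
  by apply: Opow_near (Opow0 a); near=> t; rewrite big_nil.
have [Pi|nPi] := boolP (P i); last first.
  by apply: Opow_near IHr; near=> t; rewrite big_cons (negbTE nPi).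
by apply: Opow_near (OpowD (h i Pi) IHr); near=> t; rewrite big_cons Pi.
Unshelve. all: by end_near. Qed.

Lemma Opow_sum_nat (m n : nat) (G : nat -> R -> R[i]) a :
  (forall i, (m <= i < n)%N -> Opow (G i) a) ->
  Opow (fun t => \sum_(m <= i < n) G i t) a.
Proof.
move=> h; apply: (@Opow_near (fun t => \sum_(m <= i < n | (m <= i < n)%N) G i t)).
  by near=> t; rewrite [RHS]big_nat_cond [LHS]big_nat_cond; apply: eq_bigl => i; rewrite andbb andbT.
by apply: Opow_sum.
Unshelve. all: by end_near. Qed.

Lemma Opow_prod (I : Type) (r : seq I) (P : pred I) (G : I -> R -> R[i]) :
  (forall i, P i -> Opow (G i) 0) ->
  Opow (fun t => \prod_(i <- r | P i) G i t) 0.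
Proof.
move=> h; elim: r => [|i r IHr].
  by apply: Opow_near (Opow_cst 1); near=> t; rewrite big_nil.
have [Pi|nPi] := boolP (P i); last first.
  by apply: Opow_near IHr; near=> t; rewrite big_cons (negbTE nPi).
by apply: Opow_near (OpowM_to (addr0 _) (h i Pi) IHr); near=> t; rewrite big_cons Pi.
Unshelve. all: by end_near. Qed.

End PowerGrowth.

(** [linear_growth T s] : s > 0 and T(t) - s t is bounded for large t.
    The measurement radii are of this type. *)
Definition linear_growth {R : realType} (T : R -> R) (s : R) :=
  0 < s /\ exists C : R, \forall t \near +oo, `|T t - s * t| <= C.

Section LinearGrowth.
Context {R : realType}.
Implicit Types (T : R -> R) (s a : R).

Lemma linear_growth_bounds T s : linear_growth T s ->
  \forall t \near +oo, s / 2 * t <= T t <= 2 * s * t.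
Proof.
move=> [s0 [C HC]]; near=> t.
have : `|T t - s * t| <= C by near: t.
have : 2 * C / s <= t by near: t; exact: near_pinfty_ge.
rewrite ler_pdivrMr// ler_norml => h1 /andP[h2 h3].
have : 0 < t by near: t; exact: near_pinfty_gt.
move=> t0; have st : 0 < s * t by rewrite mulr_gt0.
by apply/andP; split; nra.
Unshelve. all: by end_near. Qed.

Lemma linear_growth_gt T s (A : R) : linear_growth T s -> \forall t \near +oo, A < T t.
Proof.
move=> h; have s0 := h.1; have := linear_growth_bounds h => hb; near=> t.
have /andP[h1 _] : s / 2 * t <= T t <= 2 * s * t by near: t.
apply: lt_le_trans h1; rewrite -ltr_pdivrMl; last by rewrite divr_gt0.
by near: t; exact: near_pinfty_gt.
Unshelve. all: by end_near. Qed.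

Lemma linear_growthD T s (x : R) : linear_growth T s -> linear_growth (fun t => T t + x) s.
Proof.
move=> [s0 [C HC]]; split=> //; exists (C + `|x|); near=> t.
rewrite addrAC; apply: le_trans (ler_normD _ _) _; rewrite lerD2r.
by near: t.
Unshelve. all: by end_near. Qed.

Lemma linear_growth_near (P : set R) T s : linear_growth T s ->
  (\forall r \near +oo, P r) -> \forall t \near +oo, P (T t).
Proof.
move=> h [A [_ HA]]; have := linear_growth_gt A h => hA; near=> t.
by apply: HA; near: t.
Unshelve. all: by end_near. Qed.

(* a power of T(t) is squeezed between the same powers of (s/2) t and 2 s t *)
Lemma Opow_linear_growth T s a : linear_growth T s -> Opow (fun t => (T t `^ a)%:C) a.
Proof.
move=> h; have s0 := h.1; have hb := linear_growth_bounds h.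
exists (Num.max ((s / 2) `^ a) ((2 * s) `^ a)); near=> t.
have t0 : 0 < t by near: t; exact: near_pinfty_gt.
have /andP[h1 h2] : s / 2 * t <= T t <= 2 * s * t by near: t.
have p1 : 0 < s / 2 * t by rewrite mulr_gt0// divr_gt0.
have p2 : 0 < T t by apply: lt_le_trans h1.
have p3 : 0 < 2 * s * t by apply: lt_le_trans h2.
rewrite cabs_real ger0_norm ?powR_ge0//.
have [a0|a0] := leP 0 a.
  apply: (@le_trans _ _ ((2 * s) `^ a * t `^ a)).
    rewrite -powRM ?(ltW t0)//; last by rewrite mulr_ge0// ltW.
    by apply: ge0_ler_powR => //; rewrite nnegrE ltW.
  by rewrite ler_wpM2r ?powR_ge0// le_max lexx orbT.
apply: (@le_trans _ _ ((s / 2) `^ a * t `^ a)); last first.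
  by rewrite ler_wpM2r ?powR_ge0// le_max lexx.
rewrite -powRM ?(ltW t0)//; last by rewrite divr_ge0// ltW.
have -> : a = - (- a) by rewrite opprK.
move: (- a) (oppr_gt0 a) a0 => b <- b0; rewrite !powRN lef_pV2 ?posrE ?powR_gt0//.
by apply: ge0_ler_powR => //; rewrite ?nnegrE; exact: ltW.
Unshelve. all: by end_near. Qed.

Lemma Opow_comp (g : R -> R[i]) T s a : linear_growth T s -> Opow g a ->
  Opow (fun t => g (T t)) a.
Proof.
move=> h /OpowP[M M0 HM].
have := linear_growth_near h HM => HT.
apply: (@Opow_le_near _ (fun t => M%:C * (T t `^ a)%:C)).
  near=> t; rewrite cabsM !cabs_real !ger0_norm ?powR_ge0//.
  by near: t.
exact: OpowM_to (add0r _) (Opow_cst _) (Opow_linear_growth a h).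
Unshelve. all: by end_near. Qed.

End LinearGrowth.

(** * Inverse matrices with bounded entries *)

Section BoundedInverse.
Context {R : realType}.

Lemma Opow_det (n : nat) (M : R -> 'M[R[i]]_n) :
  (forall i j, Opow (fun t => M t i j) 0) -> Opow (fun t => \det (M t)) 0.
Proof.
move=> h; apply: Opow_sum => s _.
by apply: (OpowM_to (addr0 _)); [exact: Opow_cst|exact: Opow_prod].
Qed.

Lemma Opow_invmx (n : nat) (M : R -> 'M[R[i]]_n) :
  (forall i j, Opow (fun t => M t i j) 0) ->
  (\forall t \near +oo, \det (M t) != 0) ->
  Opow (fun t => (\det (M t))^-1) 0 ->
  forall i j, Opow (fun t => invmx (M t) i j) 0.
Proof.
move=> hM hd hV i j.
apply: (@Opow_near _ (fun t => (\det (M t))^-1 * \adj (M t) i j)).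
  near=> t.
  have dt : \det (M t) != 0 by near: t.
  by rewrite /invmx unitmxE unitfE dt !mxE.
apply: (OpowM_to (addr0 _)) => //.
apply: (@Opow_near _ (fun t => (-1) ^+ (j + i) * \det (row' j (col' i (M t))))).
  by near=> t; rewrite !mxE.
apply: (OpowM_to (addr0 _)); first exact: Opow_cst.
apply: Opow_det => i' j'; apply: (@Opow_near _ (fun t => M t (lift j i') (lift i j'))) => //.
by near=> t; rewrite !mxE.
Unshelve. all: by end_near. Qed.

End BoundedInverse.

Section Interpolation.
Context {R : realType}.
Implicit Types (a : R).

Lemma linear_growth_diff (T T' : R -> R) (s s' : R) :
  linear_growth T s -> linear_growth T' s' -> s != s' ->
  \forall t \near +oo, `|s - s'| / 2 * t <= `|T t - T' t|.
Proof.
move=> [_ [C HC]] [_ [C' HC']] ss'.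
have d0 : 0 < `|s - s'| by rewrite normr_gt0 subr_eq0.
near=> t.
have h1 : `|T t - s * t| <= C by near: t.
have h2 : `|T' t - s' * t| <= C' by near: t.
have h3 : (C + C') * 2 / `|s - s'| <= t by near: t; exact: near_pinfty_ge.
have t0 : 0 < t by near: t; exact: near_pinfty_gt.
rewrite ler_pdivrMr// in h3.
have h4 : `|(s - s') * t| <= `|T t - T' t| + (C + C').
  rewrite (_ : (s - s') * t = (T t - T' t) - (T t - s * t) + (T' t - s' * t)); last by ring.
  apply: le_trans (ler_normD _ _) _; rewrite addrA lerD//.
  by apply: le_trans (ler_normB _ _) _; rewrite lerD2l.
move: h4; rewrite normrM (gtr0_norm t0) => h4; lra.
Unshelve. all: by end_near. Qed.

(* the Vandermonde matrix of the scaled nodes t / T_i(t), which converge to the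
   distinct limits 1 / sigma_i *)
Let scaled_mx (n : nat) (T : R -> nat -> R) (t : R) : 'M[R[i]]_n :=
  \matrix_(i, j) ((t / T t i.+1) ^+ j)%:C.

Lemma det_scaled_mx (n : nat) (T : R -> nat -> R) t :
  \det (scaled_mx n T t) =
  \prod_(i < n) \prod_(j < n | (i < j)%N) (t / T t j.+1 - t / T t i.+1)%:C.
Proof.
rewrite -det_tr (_ : (scaled_mx n T t)^T
    = Vandermonde n (\row_(i < n) (t / T t i.+1)%:C)).
  rewrite det_Vandermonde; apply: eq_bigr => i _; apply: eq_bigr => j _.
  by rewrite !mxE rmorphB.
by apply/matrixP => i j; rewrite !mxE rmorphXn.
Qed.

Variables (n : nat) (T : R -> nat -> R) (sigma : nat -> R).
Hypothesis T_lin : forall i, (1 <= i <= n)%N -> linear_growth (fun t => T t i) (sigma i).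
Hypothesis sigma_inj : forall i j, (1 <= i <= n)%N -> (1 <= j <= n)%N ->
  sigma i = sigma j -> i = j.

Let T_pos : \forall t \near +oo, forall i : 'I_n, 0 < T t i.+1.
Proof.
apply: filter_forall => i; apply: linear_growth_gt.
by apply: T_lin; rewrite ltn_ord.
Qed.

Let node_diff (i j : 'I_n) : (i < j)%N ->
  (\forall t \near +oo, (t / T t j.+1 - t / T t i.+1)%:C != 0 :> R[i]) /\
  Opow (fun t => (t / T t j.+1 - t / T t i.+1)%:C^-1) 0.
Proof.
move=> ij; have li := T_lin (ltn_ord i : (1 <= i.+1 <= n)%N).
have lj := T_lin (ltn_ord j : (1 <= j.+1 <= n)%N).
have sij : sigma i.+1 != sigma j.+1.
  apply/eqP => /sigma_inj; rewrite !ltn_ord => /(_ isT isT) [e].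
  by move: ij; rewrite e ltnn.
have d0 : 0 < `|sigma i.+1 - sigma j.+1| / 2 by rewrite divr_gt0// normr_gt0 subr_eq0.
have hd := linear_growth_diff li lj sij.
have e t : 0 < t -> 0 < T t i.+1 -> 0 < T t j.+1 ->
    t / T t j.+1 - t / T t i.+1 = t * (T t i.+1 - T t j.+1) / (T t i.+1 * T t j.+1).
  by move=> *; field; rewrite !gt_eqF.
split.
  near=> t.
  have t0 : 0 < t by near: t; exact: near_pinfty_gt.
  have Tt : forall i : 'I_n, 0 < T t i.+1 by near: t.
  have h : `|sigma i.+1 - sigma j.+1| / 2 * t <= `|T t i.+1 - T t j.+1| by near: t.
  have h' : 0 < `|T t i.+1 - T t j.+1| by apply: lt_le_trans h; rewrite mulr_gt0.
  rewrite e// fmorph_eq0 mulf_eq0 invr_eq0 !mulf_eq0 !(gt_eqF t0, gt_eqF (Tt _)) /=.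
  by rewrite orbF -normr_gt0.
have hT : Opow (fun t => (T t i.+1 `^ 1)%:C * (T t j.+1 `^ 1)%:C *
    ((`|sigma i.+1 - sigma j.+1| / 2)^-1%:C * (t `^ (-2))%:C)) 0.
  apply: (@OpowM_to _ _ _ (1 + 1) (0 + - 2)); first by ring.
    by apply: OpowM; [exact: (Opow_linear_growth 1 li)|exact: (Opow_linear_growth 1 lj)].
  apply: OpowM; first exact: Opow_cst.
  by exists 1; near=> t; rewrite cabs_real ger0_norm ?powR_ge0// mul1r.
apply: Opow_le_near hT; near=> t.
have t0 : 0 < t by near: t; exact: near_pinfty_gt.
have Tt : forall i : 'I_n, 0 < T t i.+1 by near: t.
have h : `|sigma i.+1 - sigma j.+1| / 2 * t <= `|T t i.+1 - T t j.+1| by near: t.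
have h' : 0 < `|T t i.+1 - T t j.+1| by apply: lt_le_trans h; rewrite mulr_gt0.
rewrite e// !cabsM cabsV !cabs_real !powRr1 ?(ltW (Tt _))//.
rewrite powR_invn ?(ltW t0)//.
rewrite !normrM !normfV normrM !(gtr0_norm t0) !(gtr0_norm (Tt _)) (gtr0_norm d0).
rewrite [X in X <= _]invf_div ler_pM2l ?mulr_gt0//.
rewrite normrX (gtr0_norm t0) -!invfM lef_pV2 ?posrE ?(mulr_gt0 d0) ?mulr_gt0 ?exprn_gt0//.
by rewrite expr2 mulrCA ler_pM2l// mulrC.
Unshelve. all: by end_near. Qed.

Let scaled_mx_inv :
  (\forall t \near +oo, \det (scaled_mx n T t) != 0) /\
  forall i j, Opow (fun t => invmx (scaled_mx n T t) i j) 0.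
Proof.
have h0 : \forall t \near +oo, \det (scaled_mx n T t) != 0.
  have : \forall t \near +oo, forall i j : 'I_n, (i < j)%N ->
      (t / T t j.+1 - t / T t i.+1)%:C != 0 :> R[i].
    apply: filter_forall => i; apply: filter_forall => j.
    case: (boolP (i < j)%N) => ij; last by near=> t.
    have [h _] := node_diff ij; near=> t => _; by near: t.
  move=> h; near=> t; rewrite det_scaled_mx.
  apply/prodf_neq0 => i _; apply/prodf_neq0 => j ij.
  by move: i j ij; near: t.
split=> //; apply: Opow_invmx => //.
  move=> i j; have li := T_lin (ltn_ord i : (1 <= i.+1 <= n)%N).
  apply: (@Opow_near _ (fun t => (t `^ j%:R)%:C * (T t i.+1 `^ (- j%:R))%:C)).
    near=> t.
    have t0 : 0 < t by near: t; exact: near_pinfty_gt.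
    have Tt : forall i : 'I_n, 0 < T t i.+1 by near: t.
    by rewrite mxE powR_mulrn ?(ltW t0)// powR_invn ?(ltW (Tt _))// expr_div_n rmorphM.
  apply: (OpowM_to (subrr j%:R)); last exact: (Opow_linear_growth _ li).
  by exists 1; near=> t; rewrite cabs_real ger0_norm ?powR_ge0// mul1r.
apply: (@Opow_near _ (fun t => \prod_(i < n) \prod_(j < n | (i < j)%N)
   (t / T t j.+1 - t / T t i.+1)%:C^-1)).
  near=> t; rewrite det_scaled_mx -prodfV; apply: eq_bigr => i _.
  by rewrite -prodfV.
by apply: Opow_prod => i _; apply: Opow_prod => j ij; have [] := node_diff ij.
Unshelve. all: by end_near. Qed.

(** Solving the system of the matrix [Q_mx] recovers the coefficients of a
    polynomial in 1/r from approximate values at the nodes [T t i]; the j-th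
    coefficient loses a factor t^(j-1) of accuracy, because the columns of
    [Q_mx] are those of a boundedly invertible matrix scaled by t^-(j-1). *)
Lemma Q_solve_error (v : R -> 'rV[R]_2 -> R[i]) (xh : 'rV[R]_2)
    (A : nat -> R -> R[i]) a :
  (forall i, (1 <= i <= n)%N -> Opow (fun t => v t (T t i *: xh)
     - \sum_(1 <= j < n.+1) A j t * ((T t i) ^- (j - 1))%:C) a) ->
  forall j, (1 <= j <= n)%N ->
    Opow (fun t => Q_solve n (T t) (v t) xh j - A j t) (a + j%:R - 1).
Proof.
move=> hv j' j'n.
have [j ->] : exists j : 'I_n, j' = j.+1.
  by case: j' j'n => // j jn; exists (Ordinal jn).
have [hdet hinv] := scaled_mx_inv.
pose e (i : 'I_n) t := v t (T t i.+1 *: xh)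
     - \sum_(1 <= j < n.+1) A j t * ((T t i.+1) ^- (j - 1))%:C.
apply: (@Opow_near _ (fun t => (t `^ j%:R)%:C *
    \sum_(i < n) invmx (scaled_mx n T t) j i * e i t)); last first.
  apply: (@OpowM_to _ _ _ j%:R a).
  - by rewrite -natr1; ring.
  - by exists 1; near=> t; rewrite cabs_real ger0_norm ?powR_ge0// mul1r.
  apply: Opow_sum => i _; apply: (OpowM_to (add0r _)) => //.
  by apply: hv; rewrite ltn_ord.
near=> t.
have t0 : 0 < t by near: t; exact: near_pinfty_gt.
have Tt : forall i : 'I_n, 0 < T t i.+1 by near: t.
have Vu : scaled_mx n T t \in unitmx by rewrite unitmxE unitfE; near: t.
pose Dg : 'M[R[i]]_n := diag_mx (\row_j (t ^- j)%:C).
pose D' : 'M[R[i]]_n := diag_mx (\row_j (t ^+ j)%:C).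
have DD' : Dg *m D' = 1%:M.
  rewrite mulmx_diag -diag_const_mx; congr diag_mx.
  apply/rowP => i; rewrite !mxE -rmorphM mulVf ?expf_neq0 ?gt_eqF//.
have QE : Q_mx n (T t) = scaled_mx n T t *m Dg.
  apply/matrixP => i l; rewrite mul_mx_diag !mxE -rmorphM; congr (_ %:C).
  by rewrite expr_div_n mulrAC mulfV ?mul1r// expf_neq0// gt_eqF.
have Qu : Q_mx n (T t) \in unitmx.
  by rewrite QE unitmx_mul Vu; case/mulmx1_unit: DD'.
pose ec : 'cV[R[i]]_n := \col_i e i t.
pose Ac : 'cV[R[i]]_n := \col_i A i.+1 t.
have -> : Q_solve n (T t) (v t) xh j.+1
    = (invmx (Q_mx n (T t)) *m \col_(i < n) v t (T t i.+1 *: xh)) j 0.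
  by rewrite /Q_solve /entry /= valK.
have -> : \col_(i < n) v t (T t i.+1 *: xh)
    = Q_mx n (T t) *m (Ac + D' *m (invmx (scaled_mx n T t) *m ec)).
  rewrite mulmxDr {2}QE -mulmxA (mulmxA Dg) DD' mul1mx mulKVmx//.
  apply/colP => i; rewrite !mxE /e big_add1 big_mkord addrC.
  rewrite [X in _ - X + _](_ : _ = \sum_j0 Q_mx n (T t) i j0 * Ac j0 0) ?subrK//.
  by apply: eq_bigr => l _; rewrite !mxE mulrC subSS subn0.
rewrite mulKmx// mul_diag_mx !mxE [RHS]addrC addKr powR_mulrn ?(ltW t0)//.
by congr (_ * _); apply: eq_bigr => i _; rewrite !mxE.
Unshelve. all: by end_near. Qed.

End Interpolation.

Section PhaseMatrix.
Context {R : realType}.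

(** The determinant of [phase_mx] is -2i sin(kappa tau), independent of t. *)
Lemma phase_mx_inv (kappa tau : R) (t1 : R -> R) : sin (kappa * tau) != 0 ->
  (forall t, phase_mx kappa tau (t1 t) \in unitmx) /\
  forall i j, Opow (fun t => invmx (phase_mx kappa tau (t1 t)) i j) 0.
Proof.
move=> s0; pose del : R[i] := cis (- (kappa * tau)) - cis (kappa * tau).
have del0 : del != 0.
  apply/eqP => /(congr1 (fun z => complex.Im z)).
  rewrite /del /cis /= sinN => /eqP; rewrite -opprD oppr_eq0 -mulr2n mulrn_eq0.
  by rewrite (negbTE s0).
have hdet t : \det (phase_mx kappa tau (t1 t)) = del.
  rewrite (expand_det_row _ ord0) !big_ord_recl big_ord0 addr0 /cofactor.
  rewrite !det_mx11 !mxE /= expr0 mul1r expr1 mulrA mulrN1 mulNr -!cisD.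
  by rewrite /del; congr (cis _ - cis _); ring.
split=> [t|]; first by rewrite unitmxE unitfE hdet.
apply: Opow_invmx.
- move=> i j; apply: Opow_near (Opow_cis (fun t =>
    let s := if i == 0 then t1 t else t1 t + tau in
    if j == 0 then s * kappa else s * - kappa)).
  by near=> t; rewrite mxE.
- by near=> t; rewrite hdet.
- by apply: Opow_near (Opow_cst del^-1); near=> t; rewrite hdet.
Unshelve. all: by end_near. Qed.

End PhaseMatrix.

(** * Partial derivatives, directional derivatives and the Laplacian *)

Section LineDerivative.
Context {R : realType}.
Implicit Types (f g : 'rV[R]_2 -> R) (x v : 'rV[R]_2) (A : set 'rV[R]_2).

Lemma is_derive_line f x v (s df : R) : is_derive (s *: v + x) v f df ->
  is_derive s (1 : R) (fun h => f (h *: v + x)) df.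
Proof.
move=> [h1 h2].
have e : (fun h : R => h^-1 *: (((fun h => f (h *: v + x)) \o shift s) (h *: (1 : R))
    - f (s *: v + x))) =
  (fun h => h^-1 *: ((f \o shift (s *: v + x)) (h *: v) - f (s *: v + x))).
  by apply/funext => h /=; rewrite [h *: 1]mulr1 scalerDl addrA.
by apply: DeriveDef; [rewrite /derivable e|rewrite /derive e].
Qed.

Lemma MVT_abs (g g1 : R -> R) (a b : R) :
  (forall s, Num.min a b <= s <= Num.max a b -> is_derive s (1 : R) g (g1 s)) ->
  exists2 c, Num.min a b <= c <= Num.max a b & g b - g a = g1 c * (b - a).
Proof.
wlog ab : a b / a <= b.
  move=> H; have /orP[ab|ba] := le_total a b; first exact: H.
  move=> h; have [|c hc e] := H b a ba.
    by rewrite minC maxC.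
  by exists c; [rewrite minC maxC|rewrite -opprB e; ring].
rewrite (min_idPl ab) (max_idPr ab) => h.
have hd s : s \in `[a, b] -> is_derive s (1 : R) g (g1 s) by rewrite in_itv => /h.
have h1 s : s \in `]a, b[ -> is_derive s (1 : R) g (g1 s).
  by move=> hs; apply: hd; exact: subset_itv_oo_cc hs.
have h2 : {within `[a, b], continuous g}.
  by apply: derivable_within_continuous => s /hd hs; exact: ex_derive.
have [c hc e] := MVT_segment ab h1 h2.
by exists c => //; move: hc; rewrite in_itv.
Qed.

(** At a local maximum the second derivative is nonpositive. *)
Lemma second_derivative_at_max (g g1 : R -> R) (l e : R) : 0 < e ->
  (forall s : R, `|s| < e -> is_derive s (1 : R) g (g1 s)) ->
  is_derive (0 : R) 1 g1 l -> (forall s, `|s| < e -> g s <= g 0) -> l <= 0.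
Proof.
move=> e0 hg [hd hl] gmax; rewrite leNgt; apply/negP => l0.
have g10 : g1 0 = 0.
  have h : is_derive (0 : R) 1 g 0.
    apply: (@derive1_at_max R g (- e) e 0).
    - by rewrite (@le_trans _ _ 0)// ?oppr_le0 ltW.
    - move=> t; rewrite in_itv /= -ltr_norml => /hg ?; exact: ex_derive.
    - by rewrite in_itv /= oppr_lt0 e0.
    - by move=> t; rewrite in_itv /= -ltr_norml => /gmax.
  have h0 : is_derive (0 : R) 1 g (g1 0) by apply: hg; rewrite normr0.
  by rewrite -(@derive_val _ _ _ _ _ _ _ h0) (@derive_val _ _ _ _ _ _ _ h).
have : h^-1 *: (g1 (h *: 1 + 0) - g1 0) @[h --> 0^'] --> l.
  by rewrite -hl; exact: hd.
move=> /cvgrPdist_lt /(_ l l0) => -[del /= del0 hdel].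
pose m := Num.min e del / 2.
have m0 : 0 < m by rewrite divr_gt0// lt_min e0.
have me : m < e.
  by rewrite /m ltr_pdivrMr// (@le_lt_trans _ _ e)// ?ge_min ?lexx// ltr_pMr// ltr1n.
have md : m < del.
  by rewrite /m ltr_pdivrMr// (@le_lt_trans _ _ del)// ?ge_min ?lexx ?orbT// ltr_pMr// ltr1n.
have pos s : 0 < s -> s <= m -> 0 < g1 s.
  move=> s0 sm; have := hdel s; rewrite /= /ball /= sub0r normrN (gtr0_norm s0).
  move=> /(_ (le_lt_trans sm md) (lt0r_neq0 s0)).
  rewrite addr0 [s *: 1]mulr1 g10 subr0 [s^-1 *: _]/(s^-1 * _) => hh.
  have : 0 < s^-1 * g1 s.
    by move: hh; rewrite ltr_norml ltrBlDr ltrDl => /andP[].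
  by rewrite pmulr_rgt0// invr_gt0.
have h1 c : c \in `]0, m[ -> is_derive c (1 : R) g (g1 c).
  rewrite in_itv /= => /andP[c0 cm]; apply: hg.
  by rewrite gtr0_norm// (lt_trans cm).
have h2 : {within `[0, m], continuous g}.
  apply: derivable_within_continuous => s; rewrite in_itv /= => /andP[s0 sm].
  have hs : `|s| < e by rewrite ger0_norm// (le_lt_trans sm).
  exact: (@ex_derive _ _ _ _ _ _ _ (hg s hs)).
have [c /itvP c0m ec] := MVT m0 h1 h2.
have : g m <= g 0 by apply: gmax; rewrite gtr0_norm.
rewrite -subr_le0 ec subr0 pmulr_lle0// leNgt pos//; rewrite ?c0m//.
Qed.

(** A function with continuous partial derivatives has directional derivatives. *)
Lemma is_derive_dir A f x v : open A -> A x ->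
  (forall i y, A y -> derivable f y (unit_vec i)) ->
  (forall i, {for x, continuous (fun y => 'D_(unit_vec i) f y)}) ->
  is_derive x v f (\sum_(i < 2) v 0 i * 'D_(unit_vec i) f x).
Proof.
move=> oA Ax fd fc; set L := (X in is_derive _ _ _ X).
(* i0 and i1 are the two indices, kept abstract *)
have [i0 [i1 sumE]] : exists i0 i1 : 'I_2,
    forall (V : nmodType) (F : 'I_2 -> V), \sum_(i < 2) F i = F i0 + F i1.
  by exists ord0, ord_max => V F; rewrite big_ord_recr big_ord1; congr (F _ + _); exact: val_inj.
pose e0 : 'rV[R]_2 := unit_vec i0; pose e1 : 'rV[R]_2 := unit_vec i1.
have vE : v = v 0 i0 *: e0 + v 0 i1 *: e1 by rewrite {1}(row_sum_delta v) sumE.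
pose K := `|v 0 i0| * `|e0| + `|v 0 i1| * `|e1|.
have K0 : 0 <= K by rewrite addr_ge0// mulr_ge0.
suff key : forall eps : R, 0 < eps -> \forall h \near (0 : R)^',
    `|L - h^-1 *: (f (h *: v + x) - f x)| < eps.
  have cv : (fun h => h^-1 *: ((f \o shift x) (h *: v) - f x)) @ (0 : R)^' --> L.
    by apply/cvgrPdist_lt => eps /key.
  by apply: DeriveDef; [apply/cvg_ex; exists L|apply: cvg_lim].
move=> eps eps0.
pose d := eps / (`|v 0 i0| + `|v 0 i1| + 1).
have V1 : 0 < `|v 0 i0| + `|v 0 i1| + 1 by rewrite ltr_wpDl// addr_ge0.
have d0 : 0 < d by rewrite divr_gt0.
have cD i : \forall y \near x, `|'D_(unit_vec i) f x - 'D_(unit_vec i) f y| < d.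
  by have /cvgrPdist_lt := fc i; exact.
have cA : \forall y \near x, A y by apply: open_nbhs_nbhs.
have : \forall y \near x, A y /\ forall i, `|'D_(unit_vec i) f x - 'D_(unit_vec i) f y| < d.
  have cD' : \forall y \near x, forall i, `|'D_(unit_vec i) f x - 'D_(unit_vec i) f y| < d.
    exact: (@filter_forall _ 'I_2 (fun i y => `|'D_(unit_vec i) f x - 'D_(unit_vec i) f y| < d)
      (nbhs x) (nbhs_filter x) cD).
  exact: filterI cA cD'.
move=> /nbhs_ballP[r /= r0 hr].
have hr' y : `|y - x| < r -> [/\ A y, `|'D_e0 f x - 'D_e0 f y| < d & `|'D_e1 f x - 'D_e1 f y| < d].
  move=> yr; have [|h1 h2] := hr y; first by rewrite -ball_normE /= distrC.
  exact: And3 h1 (h2 i0) (h2 i1).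
exists (r / (K + 1)); first by rewrite /= divr_gt0// ltr_wpDl.
move=> h; rewrite /= /ball /= sub0r normrN => hh h0.
have hK : `|h| * K < r.
  rewrite ltr_pdivlMr ?ltr_wpDl// in hh; apply: le_lt_trans hh.
  by rewrite ler_wpM2l// lerDl.
(* move first along e0, then along e1, with a mean value on each segment *)
have near_seg (a b : R) : `|a| <= `|h * v 0 i0| -> `|b| <= `|h * v 0 i1| ->
    `|b *: e1 + (a *: e0 + x) - x| < r.
  move=> ha hb; rewrite addrA addrK; apply: le_lt_trans hK.
  apply: le_trans (ler_normD _ _) _; rewrite !normrZ addrC /K mulrDr !mulrA -!normrM.
  by apply: lerD; rewrite ler_wpM2r.
have minmax (c b : R) : Num.min 0 b <= c <= Num.max 0 b -> `|c| <= `|b|.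
  rewrite ge_min le_max => /andP[] /orP[] h1 /orP[] h2.
  - by have -> : c = 0 by [apply/eqP; rewrite eq_le h1 h2]; rewrite normr0.
  - by rewrite !ger0_norm// (le_trans h1).
  - by rewrite !ler0_norm ?lerN2// (le_trans h1).
  - by have -> : c = b by [apply/eqP; rewrite eq_le h1 h2].
have der0 s : Num.min 0 (h * v 0 i0) <= s <= Num.max 0 (h * v 0 i0) ->
    is_derive s (1 : R) (fun s => f (s *: e0 + x)) ('D_e0 f (s *: e0 + x)).
  move=> /minmax hs; apply: is_derive_line; apply: derivableP; apply: fd.
  have : `|0 *: e1 + (s *: e0 + x) - x| < r by apply: near_seg; rewrite ?normr0.
  by rewrite scale0r add0r => /hr'[].
have [c0 /minmax hc0 E0] := MVT_abs der0.
have der1 s : Num.min 0 (h * v 0 i1) <= s <= Num.max 0 (h * v 0 i1) ->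
    is_derive s (1 : R) (fun s => f (s *: e1 + ((h * v 0 i0) *: e0 + x)))
      ('D_e1 f (s *: e1 + ((h * v 0 i0) *: e0 + x))).
  move=> /minmax hs; apply: is_derive_line; apply: derivableP; apply: fd.
  by have /hr'[] := near_seg _ _ (lexx _) hs.
have [c1 /minmax hc1 E1] := MVT_abs der1.
rewrite !scale0r !add0r subr0 in E0; rewrite !scale0r !add0r subr0 in E1.
have eq1 : h *: v + x = (h * v 0 i1) *: e1 + ((h * v 0 i0) *: e0 + x).
  by rewrite {1}vE scalerDr !scalerA addrA [X in X + x]addrC.
have -> : h^-1 *: (f (h *: v + x) - f x) =
   'D_e1 f (c1 *: e1 + ((h * v 0 i0) *: e0 + x)) * v 0 i1 + 'D_e0 f (c0 *: e0 + x) * v 0 i0.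
  rewrite eq1 -(subrKA (f ((h * v 0 i0) *: e0 + x))) E1 E0.
  by rewrite -[LHS]/(h^-1 * (_ + _)) mulrDr; congr (_ + _); rewrite mulrCA mulKf.
have [_ B0 _] : [/\ A (c0 *: e0 + x), `|'D_e0 f x - 'D_e0 f (c0 *: e0 + x)| < d &
    `|'D_e1 f x - 'D_e1 f (c0 *: e0 + x)| < d].
  apply: hr'; have : `|0 *: e1 + (c0 *: e0 + x) - x| < r by apply: near_seg; rewrite ?normr0.
  by rewrite scale0r add0r.
have [_ _ B1] := hr' _ (near_seg _ c1 (lexx _) hc1).
rewrite /L sumE -/e0 -/e1.
rewrite (_ : _ - _ = v 0 i0 * ('D_e0 f x - 'D_e0 f (c0 *: e0 + x))
  + v 0 i1 * ('D_e1 f x - 'D_e1 f (c1 *: e1 + ((h * v 0 i0) *: e0 + x)))); last by ring.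
apply: le_lt_trans (ler_normD _ _) _; rewrite !normrM.
apply: (@le_lt_trans _ _ ((`|v 0 i0| + `|v 0 i1|) * d)).
  by rewrite mulrDl; apply: lerD; rewrite ler_wpM2l// ltW.
by rewrite /d mulrCA gtr_pMr// ltr_pdivrMr// mul1r ltrDl.
Unshelve. all: by end_near. Qed.

End LineDerivative.

Section LaplacianRegularity.
Context {R : realType}.
Implicit Types (f g : 'rV[R]_2 -> R) (x v : 'rV[R]_2) (A : set 'rV[R]_2).

(** The Laplacian of a real-valued function. *)
Definition lap g x : R :=
  \sum_(i < 2) 'D_(unit_vec i) (fun y => 'D_(unit_vec i) g y) x.

Lemma near_of_open A f g x : open A -> A x -> (forall y, A y -> f y = g y) ->
  \forall y \near x, f y = g y.
Proof.
move=> oA Ax e; have : nbhs x A by apply: open_nbhs_nbhs.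
exact: filterS.
Qed.

Lemma derive_eq_on A f g v x : open A -> A x -> (forall y, A y -> f y = g y) ->
  'D_v f x = 'D_v g x.
Proof. by move=> oA Ax e; apply: near_eq_derive; exact: near_of_open e. Qed.

Lemma derivable_eq_on A f g v x : open A -> A x -> (forall y, A y -> f y = g y) ->
  derivable f x v -> derivable g x v.
Proof. by move=> oA Ax e; apply: near_eq_derivable; exact: near_of_open e. Qed.

Lemma continuous_eq_on A f g x : open A -> A x -> (forall y, A y -> f y = g y) ->
  {for x, continuous f} -> {for x, continuous g}.
Proof.
move=> oA Ax e cf; have nb : {near nbhs x, f =1 g} := near_of_open oA Ax e.
have cf' : f y @[y --> x] --> g x by rewrite -(e x Ax).
exact: cvg_trans (near_eq_cvg nb) cf'.
Qed.

Lemma Cn_on_eq A n f g : open A -> (forall y, A y -> f y = g y) ->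
  Cn_on A n f -> Cn_on A n g.
Proof.
move=> oA; elim: n => [|n IHn] in f g *.
  move=> e [fc _]; split=> // x Ax.
  by apply: continuous_eq_on (fc x Ax); eassumption.
move=> e [fc fd]; split.
  by move=> x Ax; apply: continuous_eq_on (fc x Ax); eassumption.
move=> i; have [h1 h2] := fd i; split.
  by move=> x Ax; apply: derivable_eq_on (h1 x Ax); eassumption.
apply: IHn h2 => y Ay; exact: (derive_eq_on _ oA Ay e).
Qed.

Lemma Cn_on_cont A n f x : Cn_on A n f -> A x -> {for x, continuous f}.
Proof. by case: n => [|n] [h _]; exact: h. Qed.

Lemma Cn_on_derivable A n f i x : Cn_on A n.+1 f -> A x -> derivable f x (unit_vec i).
Proof. by case=> _ /(_ i)[h _]; exact: h. Qed.

Lemma Cn_on_derive A n f i : Cn_on A n.+1 f -> Cn_on A n (fun x => 'D_(unit_vec i) f x).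
Proof. by case=> _ /(_ i)[_ h]. Qed.

Lemma Cn_onW A n f : Cn_on A n.+1 f -> Cn_on A n f.
Proof.
elim: n => [|n IHn] in f *; case=> h1 h2; split=> // i.
by have [h3 h4] := h2 i; split=> //; exact: IHn.
Qed.

Lemma Cn_onD A n f g : open A -> Cn_on A n f -> Cn_on A n g ->
  Cn_on A n (fun x => f x + g x).
Proof.
move=> oA; elim: n => [|n IHn] in f g *.
  by move=> [fc _] [gc _]; split=> // x Ax; apply: continuousD; [exact: fc|exact: gc].
move=> [fc fd] [gc gd]; split.
  by move=> x Ax; apply: continuousD; [exact: fc|exact: gc].
move=> i; have [f1 f2] := fd i; have [g1 g2] := gd i; split.
  by move=> x Ax; apply: derivableD; [exact: f1|exact: g1].
apply: (Cn_on_eq oA _ (IHn _ _ f2 g2)) => y Ay.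
by rewrite deriveD//; [exact: f1|exact: g1].
Qed.

Lemma Cn_onZ A n f (a : R) : open A -> Cn_on A n f -> Cn_on A n (fun x => a * f x).
Proof.
move=> oA; elim: n => [|n IHn] in f *.
  by move=> [fc _]; split=> // x Ax; apply: continuousM; [exact: cst_continuous|exact: fc].
move=> [fc fd]; split.
  by move=> x Ax; apply: continuousM; [exact: cst_continuous|exact: fc].
move=> i; have [f1 f2] := fd i; split.
  by move=> x Ax; apply: (@derivableZ _ _ _ f); exact: f1.
apply: (Cn_on_eq oA _ (IHn _ f2)) => y Ay.
by rewrite (@deriveZ _ _ _ f)//; exact: f1.
Qed.

Lemma Cn_on_lap A n f : open A -> Cn_on A n.+2 f -> Cn_on A n (lap f).
Proof.
move=> oA h.
apply: (@Cn_on_eq A n (fun x => 'D_(unit_vec ord0) (fun y => 'D_(unit_vec ord0) f y) x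
   + 'D_(unit_vec (lift ord0 ord0)) (fun y => 'D_(unit_vec (lift ord0 ord0)) f y) x)) => //.
  by move=> y _; rewrite /lap big_ord_recl big_ord1.
by apply: Cn_onD => //; apply: Cn_on_derive; exact: Cn_on_derive.
Qed.

Lemma lap_eq_on A f g x : open A -> A x -> (forall y, A y -> f y = g y) -> lap f x = lap g x.
Proof.
move=> oA Ax e; apply: eq_bigr => i _; apply: (derive_eq_on _ oA Ax) => y Ay.
exact: (derive_eq_on _ oA Ay e).
Qed.

Lemma lapD A f g x : open A -> A x -> Cn_on A 2 f -> Cn_on A 2 g ->
  lap (fun y => f y + g y) x = lap f x + lap g x.
Proof.
move=> oA Ax hf hg; rewrite /lap -big_split /=; apply: eq_bigr => i _.
rewrite -deriveD; last first.
- by apply: (Cn_on_derivable (n := 0)) Ax; exact: Cn_on_derive.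
- by apply: (Cn_on_derivable (n := 0)) Ax; exact: Cn_on_derive.
apply: (derive_eq_on _ oA Ax) => y Ay.
rewrite -[RHS]/('D_(unit_vec i) f y + 'D_(unit_vec i) g y) -deriveD//.
- exact: Cn_on_derivable hf Ay.
- exact: Cn_on_derivable hg Ay.
Qed.

Lemma lapZ A f (a : R) x : open A -> A x -> Cn_on A 2 f ->
  lap (fun y => a * f y) x = a * lap f x.
Proof.
move=> oA Ax hf; rewrite /lap mulr_sumr; apply: eq_bigr => i _.
rewrite -[RHS](@deriveZ _ _ _ (fun y => 'D_(unit_vec i) f y)); last first.
  by apply: (Cn_on_derivable (n := 0)) Ax; exact: Cn_on_derive.
apply: (derive_eq_on _ oA Ax) => y Ay.
by rewrite -[RHS]/(a *: 'D_(unit_vec i) f y) -(@deriveZ _ _ _ f)//; exact: Cn_on_derivable hf Ay.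
Qed.

End LaplacianRegularity.

Section PlaneWave.
Context {R : realType}.
Implicit Types (x d : 'rV[R]_2).

Lemma is_derive_affine (c t0 s : R) : is_derive s (1 : R) (fun h => c * h + t0) c.
Proof.
have h := is_deriveD (is_deriveZ c (is_derive_id s (1 : R))) (is_derive_cst t0 s (1 : R)).
by apply: (is_derive_eq h); rewrite addr0 [LHS]mulr1.
Qed.

Lemma is_derive_cos_affine (c t0 s : R) :
  is_derive s (1 : R) (fun h => cos (c * h + t0)) (- (c * sin (c * s + t0))).
Proof.
have h := is_derive1_comp (is_derive_cos _) (is_derive_affine c t0 s).
by apply: (is_derive_eq h); ring.
Qed.

Lemma is_derive_sin_affine (c t0 s : R) :
  is_derive s (1 : R) (fun h => sin (c * h + t0)) (c * cos (c * s + t0)).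
Proof.
have h := is_derive1_comp (is_derive_sin _) (is_derive_affine c t0 s).
by apply: (is_derive_eq h); ring.
Qed.

Lemma dot_unit_vec d (i : 'I_2) : dot (unit_vec i) d = d 0 i.
Proof.
rewrite /dot (bigD1 i)//= big1 => [|j ji]; last by rewrite mxE eqxx (negbTE ji) mul0r.
by rewrite mxE !eqxx mul1r addr0.
Qed.

Lemma dotDl x y d : dot (x + y) d = dot x d + dot y d.
Proof. by rewrite /dot -big_split; apply: eq_bigr => i _; rewrite !mxE mulrDl. Qed.

Lemma dotZl (a : R) x d : dot (a *: x) d = a * dot x d.
Proof. by rewrite /dot mulr_sumr; apply: eq_bigr => i _; rewrite !mxE mulrA. Qed.

Lemma dotC x y : dot x y = dot y x.
Proof. by apply: eq_bigr => i _; rewrite mulrC. Qed.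

Lemma dotE x y : dot x y = x 0 ord0 * y 0 ord0 + x 0 (lift ord0 ord0) * y 0 (lift ord0 ord0).
Proof. by rewrite /dot big_ord_recl big_ord1. Qed.

Lemma coord_continuous2 (i : 'I_2) : continuous (fun x : 'rV[R]_2 => x 0 i).
Proof. exact: coord_continuous. Qed.

Lemma dot_continuous d (x : 'rV[R]_2) : {for x, continuous (fun y : 'rV[R]_2 => dot y d)}.
Proof.
rewrite (_ : (fun x => dot x d) = (fun x : 'rV[R]_2 => x 0 ord0 * d 0 ord0
  + x 0 (lift ord0 ord0) * d 0 (lift ord0 ord0))); last by apply/funext => y; exact: dotE.
have h i : {for x, continuous (fun y : 'rV[R]_2 => y 0 i * d 0 i)}.
  by apply: continuousM; [exact: coord_continuous2|exact: cst_continuous].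
by apply: continuousD; exact: h.
Qed.

Lemma is_derive_of_line (f : 'rV[R]_2 -> R) x v (df : R) :
  is_derive (0 : R) (1 : R) (fun h => f (h *: v + x)) df -> is_derive x v f df.
Proof.
have e : (fun h : R => h^-1 *: (((fun h => f (h *: v + x)) \o shift 0) (h *: (1 : R))
    - f (0 *: v + x))) = (fun h => h^-1 *: ((f \o shift x) (h *: v) - f x)).
  by apply/funext => h /=; rewrite [h *: 1]mulr1 addr0 scale0r add0r.
rewrite /=; move=> [h1 h2].
by apply: DeriveDef; [rewrite /derivable -e|rewrite /derive -e].
Qed.

(* A combination of cos and sin of k x.d: this family is stable under partial
   derivatives. *)
Let pw (k : R) d (a b : R) x := a * cos (k * dot x d) + b * sin (k * dot x d).

Let is_derive_pw k d a b x (i : 'I_2) :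
  is_derive x (unit_vec i) (pw k d a b) (pw k d (k * d 0 i * b) (- (k * d 0 i * a)) x).
Proof.
apply: is_derive_of_line; pose t0 := k * dot x d.
have e : (fun h : R => pw k d a b (h *: unit_vec i + x)) =
    (fun h => a * cos (k * d 0 i * h + t0) + b * sin (k * d 0 i * h + t0)).
  apply/funext => h; rewrite /pw dotDl dotZl dot_unit_vec /t0.
  by rewrite (_ : k * (h * d 0 i + dot x d) = k * d 0 i * h + k * dot x d)//; ring.
rewrite e /pw -/t0.
have h := is_deriveD (is_deriveZ a (is_derive_cos_affine (k * d 0 i) t0 0))
  (is_deriveZ b (is_derive_sin_affine (k * d 0 i) t0 0)).
apply: (is_derive_eq h); rewrite mulr0 add0r.
rewrite -[LHS]/(a * (- (k * d 0 i * sin t0)) + b * (k * d 0 i * cos t0)); ring.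
Qed.

Let continuous_pw k d a b (x : 'rV[R]_2) : {for x, continuous (pw k d a b)}.
Proof.
have hd : {for x, continuous (fun y : 'rV[R]_2 => k * dot y d)}.
  by apply: continuousM; [exact: cst_continuous|exact: dot_continuous].
apply: continuousD; apply: continuousM; [exact: cst_continuous| |exact: cst_continuous|].
  by apply: (@continuous_comp _ _ _ (fun y : 'rV[R]_2 => k * dot y d) (@cos R)) => //; exact: continuous_cos.
by apply: (@continuous_comp _ _ _ (fun y : 'rV[R]_2 => k * dot y d) (@sin R)) => //; exact: continuous_sin.
Qed.

Let Cn_on_pw A n k d a b : Cn_on A n (pw k d a b).
Proof.
elim: n => [|n IHn] in a b *.
  by split=> // x _; exact: continuous_pw.
split=> [x _|i]; first exact: continuous_pw.
split=> [x _|]; first by have := is_derive_pw k d a b x i => ?; exact: ex_derive.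
rewrite (_ : (fun x => 'D_(unit_vec i) (pw k d a b) x) =
  pw k d (k * d 0 i * b) (- (k * d 0 i * a)))//.
by apply/funext => x; have := is_derive_pw k d a b x i => ?; exact: derive_val.
Qed.

Let lap_pw k d a b x : enorm d = 1 -> lap (pw k d a b) x = - k ^+ 2 * pw k d a b x.
Proof.
move=> d1; have dd : d 0 ord0 ^+ 2 + d 0 (lift ord0 ord0) ^+ 2 = 1.
  have : enorm d ^+ 2 = 1 by rewrite d1 expr1n.
  by rewrite /enorm sqr_sqrtr ?dotE ?addr_ge0 -?expr2 ?sqr_ge0.
rewrite /lap (eq_bigr (fun i => - (k * d 0 i) ^+ 2 * pw k d a b x)); last first.
  move=> i _; rewrite (_ : (fun y => 'D_(unit_vec i) (pw k d a b) y) =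
    pw k d (k * d 0 i * b) (- (k * d 0 i * a))).
    have := is_derive_pw k d (k * d 0 i * b) (- (k * d 0 i * a)) x i => ?.
    by rewrite derive_val /pw; ring.
  by apply/funext => y; have := is_derive_pw k d a b y i => ?; exact: derive_val.
rewrite big_ord_recl big_ord1 -mulrDl !exprMn -opprD -mulrDr.
by rewrite dd mulr1.
Qed.

Lemma re_incident_field k d : re_fun (incident_field k d) = pw k d 1 0.
Proof. by apply/funext => x; rewrite /pw mul1r mul0r addr0. Qed.

Lemma im_incident_field k d : im_fun (incident_field k d) = pw k d 0 1.
Proof. by apply/funext => x; rewrite /pw mul1r mul0r add0r. Qed.

Lemma Cn_on_incident A n k d : Cn_on A n (re_fun (incident_field k d)) /\ Cn_on A n (im_fun (incident_field k d)).
Proof. by rewrite re_incident_field im_incident_field; split; exact: Cn_on_pw. Qed.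

Lemma lap_lap_incident k d x : enorm d = 1 ->
  lap (lap (re_fun (incident_field k d))) x = k ^+ 4 * re_fun (incident_field k d) x /\ lap (lap (im_fun (incident_field k d))) x = k ^+ 4 * im_fun (incident_field k d) x.
Proof.
move=> d1; rewrite re_incident_field im_incident_field.
have ll a b : lap (lap (pw k d a b)) x = k ^+ 4 * pw k d a b x.
  rewrite (_ : lap (pw k d a b) = (fun y => - k ^+ 2 * pw k d a b y)); last first.
    by apply/funext => y; exact: lap_pw.
  rewrite (@lapZ R setT (pw k d a b) (- k ^+ 2) x openT I); last exact: Cn_on_pw.
  by rewrite lap_pw//; ring.
by split.
Qed.

End PlaneWave.

(** * The Euclidean norm and compact annuli *)

Section EuclideanNorm.
Context {R : realType}.
Implicit Types (x : 'rV[R]_2) (a : R).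

Lemma dotxx_ge0 x : 0 <= dot x x.
Proof. by apply: sumr_ge0 => i _; rewrite -expr2 sqr_ge0. Qed.

Lemma enorm_ge0 x : 0 <= enorm x.
Proof. exact: sqrtr_ge0. Qed.

Lemma sqr_enorm x : enorm x ^+ 2 = dot x x.
Proof. by rewrite sqr_sqrtr ?dotxx_ge0. Qed.

Lemma enormZ a x : enorm (a *: x) = `|a| * enorm x.
Proof.
by rewrite /enorm dotZl dotC dotZl mulrA -expr2 sqrtrM ?sqr_ge0// sqrtr_sqr.
Qed.

Lemma enorm_gt0Z a x : 0 < a -> enorm x = 1 -> enorm (a *: x) = a.
Proof. by move=> a0 x1; rewrite enormZ x1 mulr1 gtr0_norm. Qed.

Lemma polar_decomposition x : 0 < enorm x ->
  exists2 e, enorm e = 1 & x = enorm x *: e.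
Proof.
move=> x0; exists ((enorm x)^-1 *: x).
  by rewrite enormZ gtr0_norm ?invr_gt0// mulVf// gt_eqF.
by rewrite scalerA mulfV ?scale1r// gt_eqF.
Qed.

Lemma dotxx_continuous x : {for x, continuous (fun y : 'rV[R]_2 => dot y y)}.
Proof.
rewrite (_ : (fun y => dot y y) = (fun y : 'rV[R]_2 => y 0 ord0 * y 0 ord0
  + y 0 (lift ord0 ord0) * y 0 (lift ord0 ord0))); last first.
  by apply/funext => y; exact: dotE.
by apply: continuousD; apply: continuousM; exact: coord_continuous2.
Qed.

Lemma enorm_continuous x : {for x, continuous (@enorm R)}.
Proof.
apply: (@continuous_comp _ _ _ (fun y : 'rV[R]_2 => dot y y) (@Num.sqrt R)).
  exact: dotxx_continuous.
exact: sqrt_continuous.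
Qed.

Lemma coord_le_norm x (j : 'I_2) : `|x 0 j| <= `|x|.
Proof.
have /mapP[i Hi ->] : `|x 0 j| \in [seq `|x p.1 p.2| | p : 'I_1 * 'I_2].
  by apply/mapP; exists (0, j) => //=; rewrite mem_enum.
by rewrite [leRHS]/Num.norm /= mx_normrE; apply/bigmax_geP; right => /=; exists i.
Qed.

Lemma norm_le_enorm x : `|x| <= enorm x.
Proof.
have [->|x0] := eqVneq x 0; first by rewrite normr0 enorm_ge0.
have [|[i j] /= e] := @mx_norm_neq0 _ _ _ x; first by rewrite -[mx_norm x]/`|x| normr_eq0.
rewrite [leLHS]e (ord1 i) -(@ler_pXn2r _ 2)// ?nnegrE ?enorm_ge0//.
rewrite sqr_enorm real_normK ?num_real// /dot (bigD1 j)//= -expr2 lerDl.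
by apply: sumr_ge0 => l _; rewrite -expr2 sqr_ge0.
Qed.

Lemma enorm_le_norm x : enorm x <= 2 * `|x|.
Proof.
rewrite -(@ler_pXn2r _ 2)// ?nnegrE ?enorm_ge0 ?mulr_ge0//.
rewrite sqr_enorm dotE.
have h i : x 0 i * x 0 i <= `|x| ^+ 2.
  by rewrite -expr2 -(real_normK (num_real (x 0 i))) lerXn2r ?nnegrE ?normr_ge0// coord_le_norm.
have := h ord0; have := h (lift ord0 ord0); have := sqr_ge0 `|x|.
by rewrite exprMn; lra.
Qed.

Lemma exterior_enorm (D : set 'rV[R]_2) : bounded_set D ->
  exists2 r, 0 < r & forall x, r <= enorm x -> exterior D x.
Proof.
move=> [M [_ HM]]; pose m := `|M| + 1.
have mM : M < m by rewrite (le_lt_trans (ler_norm M))// ltrDl.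
have m0 : 0 < m by rewrite ltr_wpDl.
exists (2 * m + 1); first by rewrite addr_gt0// mulr_gt0.
move=> x xm Dx; have : enorm x <= 2 * m; last by lra.
have cl : closed [set y : 'rV[R]_2 | enorm y <= 2 * m].
  by apply: (@closed_comp _ _ (@enorm R) [set r | r <= 2 * m]) => [y _|];
    [exact: enorm_continuous|exact: closed_le].
have sub : D `<=` [set y : 'rV[R]_2 | enorm y <= 2 * m].
  move=> y Dy /=; apply: le_trans (enorm_le_norm y) _; rewrite ler_pM2l//.
  exact: HM mM y Dy.
by have := closureS sub Dx; rewrite -(proj1 (closure_id _) cl).
Qed.

Lemma exterior_open (D : set 'rV[R]_2) : open (exterior D).
Proof. by rewrite openC; exact: closed_closure. Qed.

Lemma annulus_compact (r1 r2 : R) : compact [set x : 'rV[R]_2 | r1 <= enorm x <= r2].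
Proof.
apply: bounded_closed_compact.
  exists r2; split; first exact: num_real.
  move=> M rM x /= /andP[_ h]; apply: le_trans (ltW rM).
  exact: le_trans (norm_le_enorm x) h.
rewrite (_ : mkset _ = (@enorm R) @^-1` [set r | r1 <= r <= r2])//.
apply: (@closed_comp _ _ (@enorm R)) => [y _|]; first exact: enorm_continuous.
rewrite (_ : mkset _ = [set r | r1 <= r] `&` [set r | r <= r2]).
  by apply: closedI; [exact: closed_ge|exact: closed_le].
by apply/seteqP; split => r /=; [move/andP|move=> [-> ->]].
Qed.

(** A continuous function is bounded on a compact annulus. *)
Lemma bounded_on_annulus (A : set 'rV[R]_2) (r1 r2 : R) (f : 'rV[R]_2 -> R) :
  (forall x, r1 <= enorm x -> A x) -> (forall x, A x -> {for x, continuous f}) ->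
  exists2 C, 0 <= C & forall x, r1 <= enorm x <= r2 -> `|f x| <= C.
Proof.
move=> hA fc; pose K := [set x : 'rV[R]_2 | r1 <= enorm x <= r2].
have [K0|/set0P K0] := eqVneq K set0.
  by exists 0 => // x h; have : K x by []; rewrite K0.
have cf : {within K, continuous (fun x => `|f x|)}.
  apply: continuous_in_subspaceT => x /set_mem /andP[/hA /fc h _].
  by apply: (@continuous_comp _ _ _ f (@Num.norm R R)) => //; exact: norm_continuous.
have [c _ hc] := EVT_max_rV K0 (@annulus_compact r1 r2) cf.
by exists `|f c| => // x h; apply: hc; exact/mem_set.
Qed.

End EuclideanNorm.

(** * Decay of solutions of the modified Helmholtz equation *)

Section Barrier.
Context {R : realType}.
Implicit Types (p b s : R).

Lemma is_derive_quad p b s :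
  is_derive s (1 : R) (fun h => h ^+ 2 + b * h + p) (2 * s + b).
Proof.
have h := is_deriveD (is_deriveD (is_deriveX 2 (is_derive_id s (1 : R)))
  (is_deriveZ b (is_derive_id s (1 : R)))) (is_derive_cst p s (1 : R)).
by apply: (is_derive_eq h); rewrite addr0 -[LHS]/(2 * s ^+ 1 * 1 + b * 1) expr1 !mulr1.
Qed.

Lemma is_derive_quadV p b s (n : nat) : s ^+ 2 + b * s + p != 0 ->
  is_derive s (1 : R) (fun h => (h ^+ 2 + b * h + p) ^- n.+1)
    (- n.+1%:R * (s ^+ 2 + b * s + p) ^- n.+2 * (2 * s + b)).
Proof.
move=> pn; pose q h := h ^+ 2 + b * h + p.
have h := is_deriveX n.+1 (is_derive_quad p b s).
have hn : (q ^+ n.+1) s != 0.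
  by rewrite exprfctE expf_neq0.
have [d1 d2] := h.
rewrite (_ : (fun h => (h ^+ 2 + b * h + p) ^- n.+1) = (fun h => ((q ^+ n.+1) h)^-1)); last first.
  by apply/funext => y; rewrite exprfctE.
apply: DeriveDef; first exact: (@derivableV _ _ (q ^+ n.+1)).
rewrite (@deriveV _ _ (q ^+ n.+1))// d2 exprfctE.
rewrite -[LHS]/(- (q s ^+ n.+1) ^- 2 * (n.+1%:R * q s ^+ n * (2 * s + b))).
have qs : q s != 0 by [].
rewrite -/(q s); move: (q s) qs => z z0.
by rewrite !exprS; field; rewrite z0 expf_neq0.
Qed.

End Barrier.

Section MaximumPrinciple.
Context {R : realType}.
Variables (A : set 'rV[R]_2) (w : 'rV[R]_2 -> R) (k r1 C : R) (m : nat).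
Hypotheses (hA : forall x, r1 <= enorm x -> A x).
Hypotheses (w2 : Cn_on A 2 w) (wE : forall x, A x -> lap w x = k ^+ 2 * w x).
Hypotheses (k0 : 0 < k) (r10 : 0 < r1) (r1m : 2 * m.+1%:R <= k * r1) (C0 : 0 <= C).
Hypothesis wC : forall x, r1 <= enorm x -> w x <= C * (1 + enorm x).

Let B := C * (1 + r1) * r1 ^+ 2 ^+ m.+1.

(* The barrier: its decaying part dominates w on the inner circle, and its
   growing part on a large circle; lap Phi <= k^2 Phi when |x| >= r1. *)
Let Phi (eps : R) (x : 'rV[R]_2) := B * dot x x ^- m.+1 + eps * dot x x.

Let B0 : 0 <= B.
Proof. by rewrite /B !mulr_ge0 ?addr_ge0 ?exprn_ge0// ltW. Qed.

Lemma dot_line (x v : 'rV[R]_2) (s : R) : dot v v = 1 ->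
  dot (s *: v + x) (s *: v + x) = s ^+ 2 + 2 * dot x v * s + dot x x.
Proof.
by move=> v1; rewrite !(dotDl, dotZl, dotC _ (_ + _)) v1 (dotC v x); ring.
Qed.

Let line_near (c v : 'rV[R]_2) (U : set 'rV[R]_2) : nbhs c U ->
  exists2 e : R, 0 < e & forall s, `|s| < e -> U (s *: v + c).
Proof.
move=> /nbhs_ballP[r /= r0 hr]; exists (r / (`|v| + 1)).
  by rewrite divr_gt0// ltr_wpDl.
move=> s hs; apply: hr; rewrite -ball_normE /= opprD addrCA subrr addr0 normrN normrZ.
rewrite ltr_pdivlMr ?ltr_wpDl// in hs; apply: le_lt_trans hs.
by rewrite ler_wpM2l// lerDl.
Qed.

(* At a maximum of w - Phi outside the inner circle, the second derivative test
   along the two coordinate lines gives lap w <= lap Phi <= k^2 Phi. *)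
Let no_interior_max eps c : 0 < eps -> r1 < enorm c ->
  (\forall y \near c, w y - Phi eps y <= w c - Phi eps c) -> w c <= Phi eps c.
Proof.
move=> eps0 hc hmax; rewrite leNgt; apply/negP => wPhi.
have oU : open [set y : 'rV[R]_2 | r1 < enorm y].
  apply: (@open_comp _ _ (@enorm R) [set r | r1 < r]) => [y _|]; last exact: open_gt.
  exact: enorm_continuous.
have nU : nbhs c [set y | r1 < enorm y] by apply: open_nbhs_nbhs.
set q := dot c c.
have qr : r1 ^+ 2 <= q by rewrite /q -sqr_enorm lerXn2r ?nnegrE ?enorm_ge0// ltW.
have q0 : 0 < q by apply: lt_le_trans qr; rewrite exprn_gt0.
have second i : 'D_(unit_vec i) (fun y => 'D_(unit_vec i) w y) c <=
    B * (m.+1%:R * m.+2%:R * q ^- m.+3 * (2 * c 0 i) ^+ 2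
         - 2 * m.+1%:R * q ^- m.+2) + 2 * eps.
  pose v : 'rV[R]_2 := unit_vec i; set b := 2 * c 0 i.
  have cv : dot c v = c 0 i by rewrite dotC dot_unit_vec.
  have vv : dot v v = 1 by rewrite dot_unit_vec mxE !eqxx.
  have [e e0 he] := line_near v (filterI nU hmax).
  pose P s := s ^+ 2 + b * s + q.
  have PE s : dot (s *: v + c) (s *: v + c) = P s by rewrite dot_line// cv.
  have Ppos s : `|s| < e -> 0 < P s.
    move=> /he[/= h _]; rewrite -PE -sqr_enorm exprn_gt0//; exact: lt_trans h.
  pose phi1 s := B * (- m.+1%:R * P s ^- m.+2 * (2 * s + b)) + eps * (2 * s + b).
  have hphi s : `|s| < e ->
      is_derive s (1 : R) (fun h => B * P h ^- m.+1 + eps * P h) (phi1 s).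
    move=> /Ppos Ps.
    exact: (is_deriveD (is_deriveZ B (is_derive_quadV m (lt0r_neq0 Ps)))
              (is_deriveZ eps (is_derive_quad q b s))).
  have hphi1 : is_derive (0 : R) (1 : R) phi1
    (B * (m.+1%:R * m.+2%:R * q ^- m.+3 * b ^+ 2 - 2 * m.+1%:R * q ^- m.+2) + 2 * eps).
    have h1 : is_derive (0 : R) (1 : R) (fun s => 2 * s + b) 2 := is_derive_affine 2 b 0.
    have P0 : (0 : R) ^+ 2 + b * 0 + q != 0 by rewrite expr0n mulr0 !add0r gt_eqF.
    have h2 := is_deriveM (is_derive_quadV m.+1 P0) h1.
    have h3 := is_deriveD (is_deriveZ (B * - m.+1%:R) h2) (is_deriveZ eps h1).
    rewrite (_ : phi1 = (B * - m.+1%:R) \*: ((fun h : R => (h ^+ 2 + b * h + q) ^- m.+2)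
       * (fun s => 2 * s + b)) + eps \*: (fun s => 2 * s + b)); last first.
      apply/funext => s.
      rewrite /phi1 -[RHS]/((B * - m.+1%:R) * (P s ^- m.+2 * (2 * s + b)) + eps * (2 * s + b)).
      by ring.
    apply: (is_derive_eq h3).
    rewrite expr0n /= !mulr0 !add0r.
    rewrite -[LHS]/((B * - m.+1%:R) * (q ^- m.+2 * 2 +
       b * (- m.+2%:R * q ^- m.+3 * b)) + eps * 2).
    by ring.
  have hw s : `|s| < e -> is_derive s (1 : R) (fun h => w (h *: v + c)) ('D_v w (s *: v + c)).
    move=> /he[/= h _]; apply: is_derive_line; apply: derivableP.
    exact: (Cn_on_derivable w2 (hA (ltW h))).
  have hw1 : is_derive (0 : R) (1 : R) (fun h => 'D_v w (h *: v + c))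
      ('D_v (fun y => 'D_v w y) c).
    apply: (@is_derive_line R (fun y => 'D_v w y) c v 0).
    rewrite scale0r add0r; apply: derivableP.
    exact: (Cn_on_derivable (Cn_on_derive i w2) (hA (ltW hc))).
  rewrite -subr_le0.
  apply: (@second_derivative_at_max R (fun s => w (s *: v + c) - (B * P s ^- m.+1 + eps * P s))
    (fun s => 'D_v w (s *: v + c) - phi1 s) _ e e0).
  - by move=> s se; exact: (is_deriveB (hw s se) (hphi s se)).
  - move=> s /he[_ /=]; rewrite /Phi PE scale0r add0r.
    by rewrite (_ : P 0 = dot c c)// /P expr0n mulr0 !add0r.
have Ac : A c by apply: hA; exact: ltW.
have lapc : lap w c <= 4 * m.+1%:R ^+ 2 * B * q ^- m.+2 + 4 * eps.
  rewrite /lap big_ord_recl big_ord1; apply: le_trans (lerD (second _) (second _)) _.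
  have qE : q = c 0 ord0 ^+ 2 + c 0 (lift ord0 ord0) ^+ 2 by rewrite /q dotE -!expr2.
  rewrite le_eqVlt; apply/orP; left; apply/eqP.
  have -> : q ^- m.+2 = q * q ^- m.+3 by rewrite (exprS q m.+2) [in RHS]invfM mulrA mulfV ?mul1r// gt_eqF.
  rewrite -[m.+2%:R]natr1.
  move: (q ^- m.+3) => z; rewrite qE; ring.
have h1 : 4 * m.+1%:R ^+ 2 * B * q ^- m.+2 <= k ^+ 2 * (B * q ^- m.+1).
  rewrite (exprS q m.+1) [in leLHS]invfM.
  rewrite (_ : 4 * _ * B * _ = 4 * m.+1%:R ^+ 2 / q * (B * q ^- m.+1)); last by ring.
  apply: ler_wpM2r; first by rewrite mulr_ge0// invr_ge0 exprn_ge0// ltW.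
  rewrite ler_pdivrMr//; apply: (@le_trans _ _ (k ^+ 2 * r1 ^+ 2)).
    rewrite -exprMn (_ : 4 * _ = (2 * m.+1%:R) ^+ 2); last by ring.
    by rewrite lerXn2r ?nnegrE ?mulr_ge0 ?(ltW k0) ?(ltW r10).
  by rewrite ler_wpM2l ?sqr_ge0.
have h2 : 4 * eps <= k ^+ 2 * (eps * q).
  rewrite mulrCA mulrC ler_pM2l//; apply: (@le_trans _ _ (k ^+ 2 * r1 ^+ 2)); last first.
    by rewrite ler_wpM2l ?sqr_ge0.
  rewrite -exprMn (_ : 4 = 2 ^+ 2); last by rewrite -natrX.
  rewrite lerXn2r ?nnegrE ?mulr_ge0 ?(ltW k0) ?(ltW r10)//.
  by apply: le_trans r1m; rewrite ler_peMr// ler1n.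
have : k ^+ 2 * Phi eps c < k ^+ 2 * w c by rewrite ltr_pM2l ?exprn_gt0.
rewrite -wE// /Phi -/q mulrDr; lra.
Qed.

Let below_barrier eps x : 0 < eps -> r1 <= enorm x -> w x <= Phi eps x.
Proof.
(* r2 is so large that C (1 + r2) <= eps r2^2 *)
move=> eps0 hx; pose r2 := enorm x + 1 + 2 * C / eps.
have Ce : 0 <= 2 * C / eps by rewrite divr_ge0 ?mulr_ge0// ltW.
have ex0 := enorm_ge0 x.
have r2x : enorm x < r2 by rewrite /r2; lra.
have r21 : 1 <= r2 by rewrite /r2; lra.
have Cr2 : C * (1 + r2) <= eps * r2 ^+ 2.
  have : 2 * C / eps <= r2 by rewrite /r2; lra.
  rewrite ler_pdivrMr// => h; apply: (@le_trans _ _ (2 * C * r2)).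
    by rewrite [2 * C]mulrC -mulrA ler_wpM2l//; lra.
  by rewrite expr2 mulrA [eps * r2]mulrC ler_wpM2r//; lra.
pose K := [set y : 'rV[R]_2 | r1 <= enorm y <= r2].
have Kx : K x by rewrite /K /= hx ltW.
have cpsi y : r1 <= enorm y -> {for y, continuous (fun y => w y - Phi eps y)}.
  move=> hy; have y0 : dot y y != 0.
    by rewrite -sqr_enorm expf_neq0// gt_eqF// (lt_le_trans r10).
  apply: continuousB; first by apply: (Cn_on_cont w2); exact: hA.
  have cd := @dotxx_continuous R y.
  apply: continuousD; apply: continuousM; try exact: cst_continuous; last exact: cd.
  apply: continuousV; first by rewrite expf_neq0.
  apply: (@continuous_comp _ _ _ (fun y : 'rV[R]_2 => dot y y) (fun r : R => r ^+ m.+1)) => //.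
  exact: exprn_continuous.
have cK : {within K, continuous (fun y => w y - Phi eps y)}.
  by apply: continuous_in_subspaceT => y /set_mem /andP[hy _]; exact: cpsi.
have [c cKc hc] := EVT_max_rV (ex_intro _ x Kx) (@annulus_compact R r1 r2) cK.
suff : w c <= Phi eps c.
  move=> h; rewrite -subr_le0; apply: le_trans (hc x _) _; first exact/mem_set.
  by rewrite subr_le0.
have /andP[c1 c2] : K c by exact/set_mem.
have qc : 0 < dot c c by rewrite -sqr_enorm exprn_gt0// (lt_le_trans r10).
have eq0 : 0 <= eps * dot c c by rewrite mulr_ge0// ltW.
have Bq : 0 <= B * dot c c ^- m.+1 by rewrite mulr_ge0// invr_ge0 exprn_ge0// ltW.
move: c1; rewrite le_eqVlt => /orP[/eqP c1|c1].
  apply: le_trans (wC _) _; rewrite -?c1// /Phi -sqr_enorm -c1 /B.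
  rewrite mulfK ?expf_neq0 ?gt_eqF// lerDl mulr_ge0 ?exprn_ge0// ltW//.
move: c2; rewrite le_eqVlt => /orP[/eqP c2|c2].
  apply: le_trans (wC _) _; first exact: ltW.
  rewrite c2; apply: le_trans Cr2 _; rewrite /Phi -c2 sqr_enorm.
  by rewrite lerDr.
apply: no_interior_max => //.
have oU : open [set y : 'rV[R]_2 | r1 < enorm y < r2].
  rewrite (_ : mkset _ = (@enorm R) @^-1` ([set r | r1 < r] `&` [set r | r < r2])); last first.
    by apply/seteqP; split => r /=; [move/andP|move=> [-> ->]].
  apply: open_comp => [y _|]; first exact: enorm_continuous.
  by apply: openI; [exact: open_gt|exact: open_lt].
have : nbhs c [set y | r1 < enorm y < r2] by apply: open_nbhs_nbhs; split=> //=; apply/andP.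
apply: filterS => y /= /andP[y1 y2]; apply: hc; apply/mem_set.
by rewrite /K /= !ltW.
Qed.

Lemma modified_helmholtz_upper_bound x : r1 <= enorm x ->
  w x <= B / enorm x ^+ (2 * m.+1).
Proof.
move=> hx; have q0 : 0 < dot x x by rewrite -sqr_enorm exprn_gt0// (lt_le_trans r10).
apply/ler_addgt0Pr => e e0.
have := @below_barrier (e / dot x x) x (divr_gt0 e0 q0) hx.
by rewrite /Phi divfK ?gt_eqF// exprM sqr_enorm.
Qed.

End MaximumPrinciple.

(** A solution of lap w = k^2 w outside a disc that grows at most linearly
    decays faster than every power of |x|. *)
Lemma modified_helmholtz_decay {R : realType} (A : set 'rV[R]_2) (w : 'rV[R]_2 -> R)
    (k r0 C : R) (n : nat) :
  open A -> (forall x, r0 <= enorm x -> A x) -> Cn_on A 2 w ->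
  (forall x, A x -> lap w x = k ^+ 2 * w x) -> 0 < k -> 0 <= C ->
  (forall x, r0 <= enorm x -> `|w x| <= C * (1 + enorm x)) ->
  exists M r1, forall x, r1 <= enorm x -> `|w x| <= M / enorm x ^+ n.
Proof.
move=> oA hA w2 wE k0 C0 wC.
(* beyond this radius the barrier of exponent n + 1 is a supersolution *)
pose r1 := Num.max r0 (Num.max 1 (2 * n.+1%:R / k)).
have r1r0 : r0 <= r1 by rewrite /r1 le_max lexx.
have r11 : 1 <= r1 by rewrite /r1 !le_max lexx orbT.
have r10 : 0 < r1 by apply: lt_le_trans r11.
have r1n : 2 * n.+1%:R <= k * r1.
  by rewrite [k * _]mulrC -ler_pdivrMr// /r1 !le_max lexx !orbT.
have hA1 x : r1 <= enorm x -> A x by move=> h; apply: hA; exact: le_trans h.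
have wC1 x : r1 <= enorm x -> w x <= C * (1 + enorm x).
  by move=> h; apply: le_trans (ler_norm _) (wC _ (le_trans r1r0 h)).
have NwC1 x : r1 <= enorm x -> -1 * w x <= C * (1 + enorm x).
  move=> h; rewrite mulN1r; apply: le_trans (ler_norm _) _; rewrite normrN.
  exact: wC (le_trans r1r0 h).
have Nw2 : Cn_on A 2 (fun x => -1 * w x) by exact: Cn_onZ.
have NwE x : A x -> lap (fun x => -1 * w x) x = k ^+ 2 * (-1 * w x).
  by move=> Ax; rewrite (lapZ _ oA Ax w2) wE//; ring.
have h1 := modified_helmholtz_upper_bound hA1 w2 wE k0 r10 r1n C0 wC1.
have h2 := modified_helmholtz_upper_bound hA1 Nw2 NwE k0 r10 r1n C0 NwC1.
set B := C * (1 + r1) * r1 ^+ 2 ^+ n.+1 in h1 h2.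
have B0 : 0 <= B by rewrite /B !mulr_ge0 ?addr_ge0 ?exprn_ge0// ltW.
exists B, r1 => x hx.
apply: (@le_trans _ _ (B / enorm x ^+ (2 * n.+1))); last first.
  have ex1 : 1 <= enorm x by apply: le_trans hx.
  have ex0 : 0 < enorm x by apply: lt_le_trans ex1.
  rewrite ler_wpM2l// lef_pV2 ?posrE ?exprn_gt0//.
  rewrite ler_weXn2l//; by rewrite mul2n -addnn (leq_trans (leqnSn n)) ?leq_addr.
by rewrite ler_norml h1// andbT -[w x]opprK lerN2 -mulN1r h2.
Qed.

(** * Asymptotics of the scattered field *)

Section RadialGrowth.
Context {R : realType}.
Implicit Types (x e : 'rV[R]_2) (A : set 'rV[R]_2) (us : 'rV[R]_2 -> R[i]).

Lemma is_derive_ray (f : 'rV[R]_2 -> R) e (s df : R) : is_derive (s *: e) e f df ->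
  is_derive s (1 : R) (fun h => f (h *: e)) df.
Proof.
move=> h; have h' : is_derive (s *: e + 0) e f df by rewrite addr0.
have := is_derive_line h'; rewrite (_ : (fun h => f (h *: e + 0)) = fun h => f (h *: e))//.
by apply/funext => y; rewrite addr0.
Qed.

Lemma Cn_on_derivable_dir A (f : 'rV[R]_2 -> R) x v : open A -> A x -> Cn_on A 1 f ->
  derivable f x v.
Proof.
move=> oA Ax hf.
have := @is_derive_dir R A f x v oA Ax (fun i y Ay => Cn_on_derivable hf Ay)
  (fun i => Cn_on_cont (Cn_on_derive i hf) Ax).
by move=> [].
Qed.

Lemma is_derive_phase (k phi : R) (a b : R -> R) (s a1 b1 : R) :
  is_derive s (1 : R) a a1 -> is_derive s (1 : R) b b1 ->
  is_derive s (1 : R) (fun r => cos (k * r + phi) * a r + sin (k * r + phi) * b r)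
    (cos (k * s + phi) * (a1 + k * b s) + sin (k * s + phi) * (b1 - k * a s)).
Proof.
move=> ha hb.
have h := is_deriveD (is_deriveM (is_derive_cos_affine k phi s) ha)
  (is_deriveM (is_derive_sin_affine k phi s) hb).
apply: (is_derive_eq h).
rewrite -[LHS]/(cos (k * s + phi) * a1 + a s * - (k * sin (k * s + phi))
  + (sin (k * s + phi) * b1 + b s * (k * cos (k * s + phi)))).
by ring.
Qed.

(** The radiation condition bounds the radial derivative of e^{-ikr} us; hence a
    radiating field grows at most linearly. *)
Lemma radiating_linear_growth A us (k r0 : R) : open A ->
  (forall x, r0 <= enorm x -> A x) -> cCn_on A 1 us -> radiating k us ->
  exists C r1, [/\ 0 <= C, r0 <= r1 & forall x, r1 <= enorm x ->
    `|re_fun us x| <= C * (1 + enorm x) /\ `|im_fun us x| <= C * (1 + enorm x)].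
Proof.
move=> oA hA [ha hb] /(_ 1 ltr01)[r' [_ hr']].
set a := re_fun us in ha *; set b := im_fun us in hb *.
pose r1 := Num.max r0 (Num.max 1 (r' + 1)).
have r1r0 : r0 <= r1 by rewrite /r1 le_max lexx.
have r11 : 1 <= r1 by rewrite /r1 !le_max lexx orbT.
have r1r' : r' < r1.
  by apply: (@lt_le_trans _ _ (r' + 1)); rewrite ?ltrDl// /r1 !le_max lexx !orbT.
have [Ca Ca0 hCa] := @bounded_on_annulus R A r0 r1 a hA (fun x => Cn_on_cont ha).
have [Cb Cb0 hCb] := @bounded_on_annulus R A r0 r1 b hA (fun x => Cn_on_cont hb).
have r10 : 0 < r1 by apply: lt_le_trans r11.
exists (Ca + Cb + 2), r1; split=> //; first by rewrite !addr_ge0.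
move=> x hx; have x0 : 0 < enorm x by apply: lt_le_trans hx.
have [e e1 xE] := polar_decomposition x0.
set rho := enorm x in hx x0 xE *.
have inA r : r1 <= r -> A (r *: e).
  move=> h; apply: hA; rewrite enorm_gt0Z//; first exact: le_trans h.
  exact: lt_le_trans h.
have slope r : r1 <= r -> `|'D_e a (r *: e) + k * b (r *: e)| <= 1 /\
    `|'D_e b (r *: e) - k * a (r *: e)| <= 1.
  move=> h; have := hr' r (lt_le_trans r1r' h) e e1.
  set z := (X in cabs X) => hz.
  have zr : complex.Re z = 'D_e a (r *: e) + k * b (r *: e).
    rewrite /z /cderive /a /b /im_fun; case: (us (r *: e)) => p q.
    by simpc; rewrite /=; ring.
  have zi : complex.Im z = 'D_e b (r *: e) - k * a (r *: e).
    rewrite /z /cderive /a /b /re_fun; case: (us (r *: e)) => p q.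
    by simpc; rewrite /=; ring.
  have z1 : cabs z <= 1.
    apply: le_trans (ltW hz); rewrite ler_peMl ?cabs_ge0//.
    by rewrite -[leLHS]sqrtr1 ler_wsqrtr// (le_trans r11 h).
  rewrite -zr -zi; split; apply: le_trans z1; [exact: normr_Re_le|exact: normr_Im_le].
pose P phi r := cos (k * r + phi) * a (r *: e) + sin (k * r + phi) * b (r *: e).
have hP phi : `|P phi rho| <= (Ca + Cb + 2) * (1 + rho).
  pose P1 s := cos (k * s + phi) * ('D_e a (s *: e) + k * b (s *: e))
    + sin (k * s + phi) * ('D_e b (s *: e) - k * a (s *: e)).
  have dP s : Num.min r1 rho <= s <= Num.max r1 rho -> is_derive s (1 : R) (P phi) (P1 s).
    rewrite (min_idPl hx) => /andP[h _]; apply: is_derive_phase.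
      by apply: is_derive_ray; apply: derivableP; exact: Cn_on_derivable_dir (inA _ h) ha.
    by apply: is_derive_ray; apply: derivableP; exact: Cn_on_derivable_dir (inA _ h) hb.
  have trig (c d p q : R) : `|c| <= 1 -> `|d| <= 1 -> `|c * p + d * q| <= `|p| + `|q|.
    move=> hc hd; apply: le_trans (ler_normD _ _) _; rewrite !normrM.
    by apply: lerD; rewrite ler_piMl.
  have [c] := MVT_abs dP; rewrite (min_idPl hx) (max_idPr hx) => /andP[hc _] eP.
  have P1c : `|P1 c| <= 2.
    have [s1 s2] := slope c hc.
    apply: le_trans (trig _ _ _ _ (cos_max _) (sin_max _)) _.
    by rewrite (_ : 2 = 1 + 1) ?lerD//; rewrite -natr1.
  have Pr1 : `|P phi r1| <= Ca + Cb.
    apply: le_trans (trig _ _ _ _ (cos_max _) (sin_max _)) _.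
    by apply: lerD; [apply: hCa|apply: hCb]; rewrite enorm_gt0Z// r1r0 lexx.
  have -> : P phi rho = P phi r1 + P1 c * (rho - r1) by rewrite -eP; ring.
  apply: le_trans (ler_normD _ _) _.
  have : `|P1 c * (rho - r1)| <= 2 * (rho - r1).
    by rewrite normrM [`|rho - r1|]ger0_norm ?subr_ge0// ler_wpM2r// subr_ge0.
  have : 0 <= (Ca + Cb) * rho by rewrite mulr_ge0 ?addr_ge0// ltW.
  rewrite mulrDl mulrDr; lra.
(* these two phases single out the real and the imaginary part at rho *)
split.
  have := hP (- (k * rho)).
  by rewrite /P subrr cos0 sin0 mul1r mul0r addr0 -xE.
have := hP (pi / 2 - k * rho).
by rewrite /P addrCA subrr addr0 cos_pihalf sin_pihalf mul1r mul0r add0r -xE.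
Qed.

End RadialGrowth.

Section ScatteredField.
Context {R : realType}.
Implicit Types (x xh d : 'rV[R]_2) (us : 'rV[R]_2 -> R[i]).

Lemma Re_realM (r : R) (z : R[i]) : complex.Re (r%:C * z) = r * complex.Re z.
Proof. by case: z => a b; simpc. Qed.

Lemma Im_realM (r : R) (z : R[i]) : complex.Im (r%:C * z) = r * complex.Im z.
Proof. by case: z => a b; simpc. Qed.

Lemma ReB (z w : R[i]) : complex.Re (z - w) = complex.Re z - complex.Re w.
Proof. exact: raddfB. Qed.

Lemma ImB (z w : R[i]) : complex.Im (z - w) = complex.Im z - complex.Im w.
Proof. exact: raddfB. Qed.

Lemma re_laplacian us : re_fun (laplacian us) = lap (re_fun us).
Proof. by apply/funext => x; rewrite /re_fun /laplacian /lap raddf_sum. Qed.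

Lemma im_laplacian us : im_fun (laplacian us) = lap (im_fun us).
Proof. by apply/funext => x; rewrite /im_fun /laplacian /lap raddf_sum. Qed.

(** Real and imaginary parts of us minus its Helmholtz part. *)
Lemma modified_part (k : R) us x :
  complex.Re (us x - helmholtz_part k us x) =
    2^-1 * (re_fun us x + (k ^+ 2)^-1 * lap (re_fun us) x) /\
  complex.Im (us x - helmholtz_part k us x) =
    2^-1 * (im_fun us x + (k ^+ 2)^-1 * lap (im_fun us) x).
Proof.
rewrite -re_laplacian -im_laplacian /helmholtz_part /re_fun /im_fun.
rewrite [laplacian us x / _]mulrC -(fmorphV (real_complex R)).
rewrite !ReB !ImB Re_realM Im_realM ReB ImB Re_realM Im_realM.
by move: ((k ^+ 2)^-1) => c; split; field.
Qed.

Variables (k : R) (d : 'rV[R]_2) (D : set 'rV[R]_2) (us : 'rV[R]_2 -> R[i]).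
Variable f : nat -> 'rV[R]_2 -> R[i].
Hypotheses (k0 : 0 < k) (d1 : enorm d = 1) (bD : bounded_set D).
Hypothesis us4 : cCn_on (exterior D) 4 us.
Hypothesis usE : forall x, exterior D x ->
  laplacian (laplacian (total_field k d us)) x - (k ^+ 4)%:C * total_field k d us x = 0.
Hypothesis usR : radiating k us.
Hypothesis fP : atkinson_expansion k (helmholtz_part k us) f.

Let A := exterior D.
Let oA : open A. Proof. exact: exterior_open. Qed.

(* the incident field solves the same equation as the total field *)
Let bilaplacian x : A x ->
  lap (lap (re_fun us)) x = k ^+ 4 * re_fun us x /\
  lap (lap (im_fun us)) x = k ^+ 4 * im_fun us x.
Proof.
move=> Ax; have /eqP := usE Ax; rewrite subr_eq0 => /eqP e.
have [ha hb] := us4.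
have [ia ib] := @Cn_on_incident R A 4 k d.
have [la lb] := @lap_lap_incident R k d x d1.
have ll (p q : 'rV[R]_2 -> R) : Cn_on A 4 p -> Cn_on A 4 q ->
    lap (lap (fun y => p y + q y)) x = lap (lap p) x + lap (lap q) x.
  move=> hp hq; rewrite -(lapD oA Ax (Cn_on_lap oA hp) (Cn_on_lap oA hq)).
  apply: (lap_eq_on oA Ax) => y Ay.
  exact: (lapD oA Ay (Cn_onW (Cn_onW hp)) (Cn_onW (Cn_onW hq))).
have sumE (p q : 'rV[R]_2 -> R) (g : 'rV[R]_2 -> R) : Cn_on A 4 p -> Cn_on A 4 q ->
    lap (lap p) x = k ^+ 4 * p x -> g = (fun y => p y + q y) ->
    lap (lap g) x = k ^+ 4 * g x -> lap (lap q) x = k ^+ 4 * q x.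
  have alg (y1 y2 z1 z2 c : R) : y1 = c * z1 -> y1 + y2 = c * (z1 + z2) -> y2 = c * z2.
    by move=> ->; rewrite mulrDr => /addrI.
  by move=> hp hq hlp -> e1; exact: (alg _ _ _ _ _ hlp (etrans (esym (ll p q hp hq)) e1)).
split.
  apply: (sumE _ _ (re_fun (total_field k d us)) ia ha la).
    by apply/funext => y; rewrite /re_fun /total_field raddfD.
  by have := congr1 (@complex.Re R) e; rewrite Re_realM -!re_laplacian.
apply: (sumE _ _ (im_fun (total_field k d us)) ib hb lb).
  by apply/funext => y; rewrite /im_fun /total_field raddfD.
by have := congr1 (@complex.Im R) e; rewrite Im_realM -!im_laplacian.
Qed.

(* On a fixed circle u_H is bounded by continuity; by the expansion with one
   term so is f_1, and then u_H outside this circle. *)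
Let helmholtz_part_bounded : exists C r, 0 <= C /\
  forall x, r <= enorm x -> cabs (helmholtz_part k us x) <= C.
Proof.
have [rD rD0 hA] := exterior_enorm bD.
have [M [r' [_ hM]]] := fP (ltn0Sn 0).
pose r1 := Num.max rD (Num.max 1 (r' + 1)).
have r1r0 : rD <= r1 by rewrite /r1 le_max lexx.
have r11 : 1 <= r1 by rewrite /r1 !le_max lexx orbT.
have r1r' : r' < r1.
  by apply: (@lt_le_trans _ _ (r' + 1)); rewrite ?ltrDl// /r1 !le_max lexx !orbT.
have r10 : 0 < r1 by apply: lt_le_trans r11.
have [ha hb] := us4.
have cont (a : 'rV[R]_2 -> R) x : Cn_on A 4 a -> A x ->
    {for x, continuous (fun y => 2^-1 * (a y + - (k ^+ 2)^-1 * lap a y))}.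
  move=> h; have hl := Cn_on_lap oA h; have h2 : Cn_on A 2 a := Cn_onW (Cn_onW h).
  exact: (Cn_on_cont (Cn_onZ _ oA (Cn_onD oA h2 (Cn_onZ _ oA hl)))).
have [Ca Ca0 hCa] := @bounded_on_annulus R A rD r1 _ hA (fun x => cont _ x ha).
have [Cb Cb0 hCb] := @bounded_on_annulus R A rD r1 _ hA (fun x => cont _ x hb).
have uH1 x : enorm x = r1 -> cabs (helmholtz_part k us x) <= Ca + Cb.
  move=> xr; apply: le_trans (cabs_le_ReIm _) _.
  have hx : rD <= enorm x <= r1 by rewrite xr r1r0 lexx.
  have [eR eI] := modified_part k us x.
  rewrite (_ : helmholtz_part k us x = us x - (us x - helmholtz_part k us x)); last by rewrite subKr.
  rewrite ReB ImB eR eI; apply: lerD.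
    apply: le_trans (hCa x hx); rewrite le_eqVlt; apply/orP; left; apply/eqP; congr `|_|.
    by rewrite /re_fun; field; rewrite gt_eqF.
  apply: le_trans (hCb x hx); rewrite le_eqVlt; apply/orP; left; apply/eqP; congr `|_|.
  by rewrite /im_fun; field; rewrite gt_eqF.
pose g r e := helmholtz_part k us (r *: e) / (cis (k * r) / (Num.sqrt r)%:C).
have gE r e : cabs (g r e) = cabs (helmholtz_part k us (r *: e)) * Num.sqrt r.
  rewrite /g; move: (helmholtz_part k us (r *: e)) => z.
  by rewrite !(cabsM, cabsV) cabs_cis cabs_real mul1r invrK ger0_norm ?sqrtr_ge0.
have hg r e : r' < r -> 1 <= r -> enorm e = 1 -> cabs (g r e - f 1 e) <= `|M|.
  move=> rr' r1' e1; have := hM r rr' e e1; rewrite big_nat1 expr0 divr1 expr1 => h.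
  apply: le_trans h _; apply: le_trans (ler_norm _) _.
  have r0 : 0 < r by apply: lt_le_trans r1'.
  by rewrite normrM normfV (gtr0_norm r0) ler_pdivrMr// ler_peMr.
have f1 e : enorm e = 1 -> cabs (f 1 e) <= (Ca + Cb) * Num.sqrt r1 + `|M|.
  move=> e1; rewrite -[f 1 e](subKr (g r1 e)); apply: le_trans (cabsD _ _) _.
  rewrite cabsN; apply: lerD; last exact: hg.
  by rewrite gE ler_wpM2r ?sqrtr_ge0// uH1// enorm_gt0Z.
exists ((Ca + Cb) * Num.sqrt r1 + `|M| + `|M|), r1; split.
  by rewrite !addr_ge0// mulr_ge0 ?sqrtr_ge0// addr_ge0.
move=> x hx; have x0 : 0 < enorm x by apply: lt_le_trans hx.
have [e e1 ->] := polar_decomposition x0; set rho := enorm x in hx x0 *.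
apply: (@le_trans _ _ (cabs (g rho e))).
  rewrite gE ler_peMr ?cabs_ge0// -[leLHS]sqrtr1 ler_wsqrtr//.
  exact: le_trans hx.
rewrite -[g rho e](subrK (f 1 e)) addrC; apply: le_trans (cabsD _ _) _.
apply: lerD; first exact: f1.
by apply: hg => //; [exact: lt_le_trans hx|exact: le_trans hx].
Qed.

(** The part of us that solves the modified Helmholtz equation decays faster
    than every power of |x|. *)
Lemma modified_part_decay (n : nat) : exists M r1, forall x, r1 <= enorm x ->
  cabs (us x - helmholtz_part k us x) <= M / enorm x ^+ n.
Proof.
have [rD rD0 hA] := exterior_enorm bD.
have [ha hb] := us4.
have us1 : cCn_on A 1 us.
  by split; [exact: (Cn_onW (Cn_onW (Cn_onW ha)))|exact: (Cn_onW (Cn_onW (Cn_onW hb)))].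
have [C [r1 [C0 r1D hC]]] := radiating_linear_growth oA hA us1 usR.
have [C' [r2 [C'0 hC']]] := helmholtz_part_bounded.
pose r0 := Num.max r1 r2.
have r01 : r1 <= r0 by rewrite /r0 le_max lexx.
have r02 : r2 <= r0 by rewrite /r0 le_max lexx orbT.
have hA0 x : r0 <= enorm x -> A x.
  by move=> h; apply: hA; apply: le_trans r1D _; apply: le_trans h.
have reg (a : 'rV[R]_2 -> R) : Cn_on A 4 a ->
    Cn_on A 2 (fun y => 2^-1 * (a y + (k ^+ 2)^-1 * lap a y)).
  move=> h; have hl := Cn_on_lap oA h.
  exact: (Cn_onZ _ oA (Cn_onD oA (Cn_onW (Cn_onW h)) (Cn_onZ _ oA hl))).
have eqn (a : 'rV[R]_2 -> R) : Cn_on A 4 a ->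
    (forall x, A x -> lap (lap a) x = k ^+ 4 * a x) -> forall x, A x ->
    lap (fun y => 2^-1 * (a y + (k ^+ 2)^-1 * lap a y)) x =
    k ^+ 2 * (2^-1 * (a x + (k ^+ 2)^-1 * lap a x)).
  move=> h ll x Ax; have hl := Cn_on_lap oA h.
  have h2 : Cn_on A 2 a := Cn_onW (Cn_onW h).
  have hl2 := Cn_onZ ((k ^+ 2)^-1) oA hl.
  rewrite (lapZ _ oA Ax (Cn_onD oA h2 hl2)) (lapD oA Ax h2 hl2) (lapZ _ oA Ax hl) ll//.
  by field; rewrite gt_eqF.
have bound x : r0 <= enorm x ->
    `|complex.Re (us x - helmholtz_part k us x)| <= (C + C') * (1 + enorm x) /\
    `|complex.Im (us x - helmholtz_part k us x)| <= (C + C') * (1 + enorm x).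
  move=> hx; have [hr hi] := hC x (le_trans r01 hx).
  have hH := hC' x (le_trans r02 hx).
  have H1 := le_trans (normr_Re_le _) hH; have H2 := le_trans (normr_Im_le _) hH.
  have cx : 0 <= C' * enorm x by rewrite mulr_ge0// enorm_ge0.
  rewrite ReB ImB; split; apply: le_trans (ler_normB _ _) _;
    rewrite /re_fun /im_fun in hr hi; lra.
have bR x : r0 <= enorm x ->
    `|2^-1 * (re_fun us x + (k ^+ 2)^-1 * lap (re_fun us) x)| <= (C + C') * (1 + enorm x).
  by move=> hx; rewrite -(proj1 (modified_part k us x)); exact: (proj1 (bound x hx)).
have bI x : r0 <= enorm x ->
    `|2^-1 * (im_fun us x + (k ^+ 2)^-1 * lap (im_fun us) x)| <= (C + C') * (1 + enorm x).
  by move=> hx; rewrite -(proj2 (modified_part k us x)); exact: (proj2 (bound x hx)).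
have eqR := eqn _ ha (fun x Ax => proj1 (bilaplacian Ax)).
have eqI := eqn _ hb (fun x Ax => proj2 (bilaplacian Ax)).
have CC0 := addr_ge0 C0 C'0.
have [M1 [s1 h1]] := modified_helmholtz_decay n oA hA0 (reg _ ha) eqR k0 CC0 bR.
have [M2 [s2 h2]] := modified_helmholtz_decay n oA hA0 (reg _ hb) eqI k0 CC0 bI.
exists (M1 + M2), (Num.max s1 s2) => x; rewrite ge_max => /andP[hs1 hs2].
apply: le_trans (cabs_le_ReIm _) _.
have [-> ->] := modified_part k us x; rewrite mulrDl.
by apply: lerD; [exact: h1|exact: h2].
Qed.

(** The scattered field inherits the expansion of its Helmholtz part. *)
Lemma scattered_field_expansion xh (n : nat) : (0 < n)%N -> enorm xh = 1 ->
  Opow (fun r => (Num.sqrt r)%:C * us (r *: xh)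
    - cis (k * r) * \sum_(1 <= j < n.+1) f j xh * (r ^- (j - 1))%:C) (- n%:R).
Proof.
move=> n0 xh1.
have [M1 [r1 hM]] := modified_part_decay n.+1.
have [M2 hf] := fP n0.
(* one extra power absorbs the factor sqrt r *)
have o1 : Opow (fun r => (Num.sqrt r)%:C * (us (r *: xh) - helmholtz_part k us (r *: xh))) (- n%:R).
  apply: (@Opow_weaken _ _ (2^-1 + - n.+1%:R)); first by rewrite -[n.+1%:R]natr1; lra.
  apply: OpowM.
    exists 1; near=> r; have r0 : 0 < r by near: r; exact: near_pinfty_gt.
    by rewrite cabs_real ger0_norm ?sqrtr_ge0// mul1r powR12_sqrt// ltW.
  exists M1; near=> r; have r0 : 0 < r by near: r; exact: near_pinfty_gt.
  rewrite powR_invn ?(ltW r0)//; have := hM (r *: xh); rewrite enorm_gt0Z//; apply.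
  by near: r; exact: near_pinfty_ge.
have o2 : Opow (fun r => cis (k * r) *
    (helmholtz_part k us (r *: xh) / (cis (k * r) / (Num.sqrt r)%:C)
      - \sum_(1 <= j < n.+1) f j xh / (r ^+ (j - 1))%:C)) (- n%:R).
  apply: (OpowM_to (add0r _)); first exact: Opow_cis.
  exists M2; near=> r; have r0 : 0 < r by near: r; exact: near_pinfty_gt.
  rewrite powR_invn ?(ltW r0)//.
  have h : forall xh0, enorm xh0 = 1 ->
      cabs (helmholtz_part k us (r *: xh0) / (cis (k * r) / (Num.sqrt r)%:C)
            - \sum_(1 <= j < n.+1) f j xh0 / (r ^+ (j - 1))%:C) <= M2 / r ^+ n.
    by near: r.
  exact: h.
apply: Opow_near (OpowD o1 o2); near=> r.
have r0 : 0 < r by near: r; exact: near_pinfty_gt.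
have s0 : (Num.sqrt r)%:C != 0 :> R[i] by rewrite fmorph_eq0 gt_eqF// sqrtr_gt0.
rewrite (eq_bigr (fun j => f j xh * (r ^- (j - 1))%:C)); last first.
  by move=> j _; rewrite fmorphV.
move: (\sum_(_ <= _ < _) _) (cis_neq0 (k * r)) => S; move: (cis (k * r)) => c c0.
by field; rewrite c0 s0.
Unshelve. all: by end_near. Qed.

End ScatteredField.

(** * Expansion of the phaseless data *)

Section PhaselessData.
Context {R : realType}.
Implicit Types (f g : nat -> R[i]) (r : R).

Lemma sum_ord_nat (V : nmodType) (n : nat) (F : nat -> V) :
  \sum_(1 <= j < n.+1) F j = \sum_(j < n) F j.+1.
Proof. by rewrite big_add1 big_mkord. Qed.

Lemma Opow_powR (a : R) : Opow (fun r => (r `^ a)%:C) a.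
Proof.
exists 1; near=> r; rewrite mul1r cabs_real ger0_norm ?powR_ge0//.
Unshelve. all: by end_near. Qed.

Lemma Opow_exprV (j : nat) : Opow (fun r : R => (r ^- j)%:C) (- j%:R).
Proof.
apply: Opow_near (Opow_powR (- j%:R)); near=> r.
have r0 : 0 < r by near: r; exact: near_pinfty_gt.
by rewrite powR_invn// ltW.
Unshelve. all: by end_near. Qed.

Lemma conj_realC (x : R) : (x%:C)^*%C = x%:C.
Proof. by rewrite /= oppr0. Qed.

Lemma conjCM (z w : R[i]) : (z * w)^*%C = z^*%C * w^*%C.
Proof. exact: rmorphM. Qed.

Lemma conjCD (z w : R[i]) : (z + w)^*%C = z^*%C + w^*%C.
Proof. exact: rmorphD. Qed.

Lemma conjCB (z w : R[i]) : (z - w)^*%C = z^*%C - w^*%C.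
Proof. exact: rmorphB. Qed.

Lemma conjC_sum (I : Type) (s : seq I) (F : I -> R[i]) :
  (\sum_(i <- s) F i)^*%C = \sum_(i <- s) (F i)^*%C.
Proof. exact: rmorph_sum. Qed.

(** [self_conv f] gives the coefficients of the squared modulus of the
    polynomial in 1/r with coefficients f. *)
Lemma sqr_modulus_expansion f (n : nat) :
  Opow (fun r => (\sum_(1 <= j < n.+1) f j * (r ^- (j - 1))%:C)
      * (\sum_(1 <= j < n.+1) f j * (r ^- (j - 1))%:C)^*%C
    - \sum_(1 <= j < n.+1) self_conv f j * (r ^- (j - 1))%:C) (- n%:R).
Proof.
(* with x = 1/r, both factors are polynomials in x of degree less than n *)
pose p := \poly_(i < n) f i.+1; pose q := \poly_(i < n) (f i.+1)^*%C.
have hornerE (g : nat -> R[i]) r :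
    \sum_(1 <= j < n.+1) g j * (r ^- (j - 1))%:C = (\poly_(i < n) g i.+1).[(r^-1)%:C].
  rewrite horner_poly sum_ord_nat; apply: eq_bigr => j _.
  by rewrite subSS subn0 -exprVn rmorphXn.
have conjE r : (\sum_(1 <= j < n.+1) f j * (r ^- (j - 1))%:C)^*%C = q.[(r^-1)%:C].
  rewrite -(hornerE (fun j => (f j)^*%C)) conjC_sum; apply: eq_bigr => j _.
  by rewrite conjCM conj_realC.
have hsize : (size (p * q)%R <= n + (n + n))%N.
  apply: leq_trans (size_polyMleq _ _) _; apply: leq_trans (leq_pred _) _.
  by rewrite (leq_trans (leq_add (size_poly _ _) (size_poly _ _)))// leq_addl.
apply: (@Opow_near _ (fun r => \sum_(i < n + n) (p * q)`_(n + i) * (r ^- (n + i))%:C)).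
  near=> r; rewrite conjE !hornerE -hornerM.
  rewrite (horner_coef_wide _ hsize) [in RHS]big_split_ord /=.
  rewrite horner_poly [X in _ = X + _ - _](_ : _ = \sum_(i < n) self_conv f i.+1 * (r^-1)%:C ^+ i).
    rewrite addrAC subrr add0r; apply: eq_bigr => i _.
    by rewrite -exprVn rmorphXn.
  apply: eq_bigr => i _; congr (_ * _); rewrite coefM /self_conv sum_ord_nat.
  apply: eq_bigr => l _; rewrite !coef_poly subSS addn1.
  rewrite (leq_trans (ltn_ord l))//.
  by rewrite (leq_ltn_trans (leq_subr _ _))// ltn_ord.
apply: Opow_sum => i _; apply: (OpowM_to (add0r _)); first exact: Opow_cst.
apply: (Opow_weaken _ (Opow_exprV (n + i))).
by rewrite lerN2 ler_nat leq_addr.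
Unshelve. all: by end_near. Qed.

(** Errors of the coefficients f propagate to [self_conv f]. *)
Lemma self_conv_error (fh : R -> nat -> R[i]) f (c : R) (N : nat) : N%:R <= c ->
  (forall l, (1 <= l <= N)%N -> Opow (fun t => fh t l - f l) (l%:R - c)) ->
  forall j, (1 <= j <= N)%N ->
    Opow (fun t => self_conv (fh t) j - self_conv f j) (j%:R - c).
Proof.
move=> Nc h j /andP[j1 jN].
have bd l : (1 <= l <= N)%N -> Opow (fun t => fh t l) 0.
  move=> lN; have /andP[_ lN'] := lN.
  have e : l%:R - c <= 0.
    by rewrite subr_le0; apply: le_trans Nc; rewrite ler_nat.
  apply: Opow_near (OpowD (Opow_weaken e (h l lN)) (Opow_cst (f l))).
  by near=> t; rewrite subrK.
apply: (@Opow_near _ (fun t => \sum_(1 <= l < j.+1)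
   ((fh t l - f l) * (fh t (j - l + 1)%N)^*%C
    + f l * (fh t (j - l + 1)%N - f (j - l + 1)%N)^*%C))).
  near=> t; rewrite /self_conv -sumrB; apply: eq_bigr => l _.
  by rewrite conjCB; ring.
apply: Opow_sum_nat => l /andP[l1 lj]; rewrite ltnS in lj.
have m1 : (1 <= j - l + 1)%N by rewrite addn1.
have mj : (j - l + 1 <= j)%N by rewrite addn1 -subSn// leq_subLR -add1n leq_add2r.
have mN : (1 <= j - l + 1 <= N)%N by rewrite m1 (leq_trans mj).
have lN : (1 <= l <= N)%N by rewrite l1 (leq_trans lj).
apply: OpowD.
  apply: (@Opow_weaken _ _ (l%:R - c)); first by rewrite lerD2r ler_nat.
  by apply: (OpowM_to (addr0 _)); [exact: h|apply: Opow_conj; exact: bd].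
apply: (@Opow_weaken _ _ ((j - l + 1)%:R - c)); first by rewrite lerD2r ler_nat.
by apply: (OpowM_to (add0r _)); [exact: Opow_cst|apply: Opow_conj; exact: h].
Unshelve. all: by end_near. Qed.

End PhaselessData.

Section DataExpansion.
Context {R : realType}.
Implicit Types (f : nat -> R[i]) (kappa s : R).

(** Amplitude of r^-(j-1) in the oscillating part of the data at phase kappa s. *)
Definition amplitude kappa f s (j : nat) : R[i] :=
  cis (s * kappa) * f j + cis (s * - kappa) * (f j)^*%C.

Lemma powR_half_sub (r : R) (j : nat) : 0 < r -> (0 < j)%N ->
  r `^ (2^-1 - j%:R) = (Num.sqrt r)^-1 * r ^- (j - 1).
Proof.
move=> r0 j0; have -> : (2^-1 - j%:R : R) = - 2^-1 + - (j - 1)%:R by rewrite natrB//; lra.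
rewrite powRD; last by apply/implyP => _; rewrite gt_eqF.
by rewrite powRN powR12_sqrt ?(ltW r0)// powR_invn ?(ltW r0).
Qed.

(** The data along the direction xh. In u = u^i + us the cross terms with the
    incident field give the oscillating part, and the squared modulus of us the
    part with the coefficients [self_conv f]. *)
Lemma data_expansion (k : R) (d xh : 'rV[R]_2) (us : 'rV[R]_2 -> R[i])
    (f : nat -> R[i]) (n : nat) :
  Opow (fun r => (Num.sqrt r)%:C * us (r *: xh)
    - cis (k * r) * \sum_(1 <= j < n.+1) f j * (r ^- (j - 1))%:C) (- n%:R) ->
  Opow (fun r =>
      (Num.sqrt r * (cabs (total_field k d us (r *: xh)) ^+ 2 - 1))%:C
      - (\sum_(1 <= j < n.+1) amplitude (phase_rate k xh d) f r j * (r ^- (j - 1))%:C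
         + \sum_(1 <= j < n.+1) self_conv f j * (r `^ (2^-1 - j%:R))%:C)) (- n%:R).
Proof.
pose S r := \sum_(1 <= j < n.+1) f j * (r ^- (j - 1))%:C.
pose e r := (Num.sqrt r)%:C * us (r *: xh) - cis (k * r) * S r.
pose H r := \sum_(1 <= j < n.+1) self_conv f j * (r ^- (j - 1))%:C.
pose ci (r : R) : R[i] := incident_field k d (r *: xh).
move=> he; have {}he : Opow e (- n%:R) by [].
have hS : Opow S 0.
  apply: Opow_sum_nat => j _; apply: (OpowM_to (add0r _)); first exact: Opow_cst.
  by apply: (Opow_weaken _ (Opow_exprV _)); rewrite oppr_le0.
have hs : Opow (fun r : R => (Num.sqrt r)^-1%:C) 0.
  apply: (@Opow_weaken _ _ (- 2^-1)); first by rewrite oppr_le0 invr_ge0.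
  apply: Opow_near (Opow_powR (- 2^-1)); near=> r.
  have r0 : 0 < r by near: r; exact: near_pinfty_gt.
  by rewrite powRN powR12_sqrt// ltW.
have hci : Opow ci 0 by exact: Opow_cis.
have hc : Opow (fun r : R => cis (k * r)) 0 by exact: Opow_cis.
have N0 : (- n%:R : R) <= 0 by rewrite oppr_le0.
have he0 := Opow_weaken N0 he.
have M0 (g g' : R -> R[i]) : Opow g 0 -> Opow g' (- n%:R) -> Opow (fun r => g r * g' r) (- n%:R).
  by apply: OpowM_to; rewrite add0r.
apply: (@Opow_near _ (fun r => (ci r * (e r)^*%C + (ci r)^*%C * e r) +
   ((Num.sqrt r)^-1%:C * (S r * (S r)^*%C - H r) +
    (Num.sqrt r)^-1%:C * ((cis (k * r) * S r) * (e r)^*%C +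
       (cis (k * r) * S r)^*%C * e r + e r * (e r)^*%C)))); last first.
  have hcS : Opow (fun r => cis (k * r) * S r) 0 by apply: (OpowM_to (addr0 _)).
  apply: OpowD.
    by apply: OpowD; apply: (M0 _ _) => //; exact: Opow_conj.
  apply: OpowD; apply: (M0 _ _) => //; first exact: sqr_modulus_expansion.
  apply: OpowD; last by apply: (M0 _ _) => //; exact: Opow_conj.
  by apply: OpowD; apply: (M0 _ _) => //; exact: Opow_conj.
near=> r.
have r0 : 0 < r by near: r; exact: near_pinfty_gt.
have sumA : \sum_(1 <= j < n.+1) amplitude (phase_rate k xh d) f r j * (r ^- (j - 1))%:C
    = (cis (k * r) * (ci r)^*%C) * S r + ((cis (k * r))^*%C * ci r) * (S r)^*%C.
  have c1 : cis (k * r) * (ci r)^*%C = cis (r * phase_rate k xh d).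
    rewrite /ci /incident_field cis_conj -cisD dotZl /phase_rate; congr cis; ring.
  have c2 : (cis (k * r))^*%C * ci r = cis (r * - phase_rate k xh d).
    rewrite /ci /incident_field cis_conj -cisD dotZl /phase_rate; congr cis; ring.
  rewrite c1 c2 /S conjC_sum !mulr_sumr -big_split /=; apply: eq_bigr => j _.
  by rewrite /amplitude conjCM conj_realC; ring.
have sumH : \sum_(1 <= j < n.+1) self_conv f j * (r `^ (2^-1 - j%:R))%:C =
    (Num.sqrt r)^-1%:C * H r.
  rewrite /H mulr_sumr; apply: eq_big_nat => j /andP[j1 _].
  by rewrite powR_half_sub// rmorphM /= mulrCA.
have cc : cis (k * r) * (cis (k * r))^*%C = 1 by rewrite cis_conj cisN mulfV// cis_neq0.
have cici : ci r * (ci r)^*%C = 1 by rewrite /ci cis_conj cisN mulfV// cis_neq0.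
have usE : us (r *: xh) = (Num.sqrt r)^-1%:C * (e r + cis (k * r) * S r).
  by rewrite /e subrK mulrA -rmorphM /= mulVf ?mul1r// gt_eqF// sqrtr_gt0.
have dataE (z : R[i]) : (Num.sqrt r * (cabs z ^+ 2 - 1))%:C = (Num.sqrt r)%:C * (z * z^*%C - 1).
  by rewrite -sqr_cabsC rmorphM rmorphB.
rewrite sumA sumH dataE.
rewrite /total_field -/(ci r) usE.
move: (S r) (e r) (H r) (ci r) (cis (k * r)) cc cici => S0 e0 H0 c0 c1 cc cici.
rewrite !(conjCD, conjCM) !conj_realC.
have qq : (Num.sqrt r)%:C * (Num.sqrt r)^-1%:C = 1 :> R[i].
  by rewrite -rmorphM /= mulfV// gt_eqF// sqrtr_gt0.
move: ((Num.sqrt r)%:C) ((Num.sqrt r)^-1%:C) qq => q q' qq.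
move: S0^*%C e0^*%C c0^*%C cici c1^*%C cc => S0' e0' c0' cici c1' cc.
(* with q q' = c0 c0' = c1 c1' = 1 this is an identity of polynomials *)
have -> : q * ((c0 + q' * (e0 + c1 * S0)) * (c0' + q' * (e0' + c1' * S0')) - 1) =
    q * (c0 * c0' - 1) + (q * q') * (c0 * (e0' + c1' * S0') + c0' * (e0 + c1 * S0))
    + (q * q') * q' * ((c1 * c1') * S0 * S0' + c1 * S0 * e0' + c1' * S0' * e0 + e0 * e0').
  by ring.
by rewrite cici qq cc subrr mulr0; ring.
Unshelve. all: by end_near. Qed.

(** The zeros of sin are the integer multiples of pi. *)
Lemma sin_eq0_int (x : R) : sin x = 0 -> exists l : int, x = l%:~R * pi.
Proof.
move=> s0; pose l := Num.floor (x / pi); exists l.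
have natD (m : nat) (y : R) : sin y = 0 -> sin (y + m%:R * pi) = 0 /\ sin (y - m%:R * pi) = 0.
  move=> y0; elim: m => [|m [IH1 IH2]]; first by rewrite mul0r subr0 addr0.
  have e1 : y + m.+1%:R * pi = (y + m%:R * pi) + pi by rewrite -natr1; ring.
  have e2 : y - m.+1%:R * pi = (y - m%:R * pi) - pi by rewrite -natr1; ring.
  by rewrite e1 e2 sinDpi IH1 oppr0 sinB IH2 sinpi mul0r mulr0 subr0.
have : sin (x - l%:~R * pi) = 0.
  case: (l) => m; first by have [] := natD m x s0.
  by rewrite NegzE mulrNz mulNr opprK; have [] := natD m.+1 x s0.
have p0 := @pi_gt0 R.
have /andP[] := floor_itv (x / pi); rewrite -/l ler_pdivlMr// ltr_pdivrMr// intrD mulrDl mul1r.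
move=> h1 h2 s1; apply/eqP; rewrite -subr_eq0; apply/negPn/negP => y0.
have : 0 < sin (x - l%:~R * pi).
  apply: sin_gt0_pi; rewrite lt_neqAle eq_sym y0 subr_ge0 h1 /=.
  by rewrite ltrBlDl.
by rewrite s1 ltxx.
Qed.

End DataExpansion.

(** * Retrieval of the coefficients *)

Section Retrieval.
Context {R : realType}.
Variables (u : 'rV[R]_2 -> R[i]) (xh : 'rV[R]_2) (f : nat -> R[i]) (n : nat) (kappa : R).
Hypothesis xh1 : enorm xh = 1.
Hypothesis dataP : Opow (fun r =>
  (Num.sqrt r * (cabs (u (r *: xh)) ^+ 2 - 1))%:C
  - (\sum_(1 <= j < n.+1) amplitude kappa f r j * (r ^- (j - 1))%:C
     + \sum_(1 <= j < n.+1) self_conv f j * (r `^ (2^-1 - j%:R))%:C)) (- n%:R).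

(** Sampling the corrected data along radii growing linearly with t leaves only
    the oscillating part, up to O(t^a): a bounds the remainder of the expansion,
    the errors of the coefficients hh and the terms of order above N. *)
Lemma corrected_data_error (T : R -> R) (s a : R) (N : nat) (hh : R -> nat -> R[i]) :
  linear_growth T s -> (N <= n)%N -> - n%:R <= a ->
  (forall j, (1 <= j <= N)%N ->
     Opow (fun t => hh t j - self_conv f j) (a + j%:R - 2^-1)) ->
  (forall j, (N < j <= n)%N -> 2^-1 - j%:R <= a) ->
  Opow (fun t => corrected_data u N (hh t) (T t *: xh)
    - \sum_(1 <= j < n.+1) amplitude kappa f (T t) j * ((T t) ^- (j - 1))%:C) a.
Proof.
move=> hT Nn na hhP tail.
have o1 := Opow_weaken na (Opow_comp hT dataP).
have o2 : Opow (fun t => \sum_(1 <= j < N.+1)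
    - ((hh t j - self_conv f j) * (T t `^ (2^-1 - j%:R))%:C)) a.
  apply: Opow_sum_nat => j jN; apply: OpowN.
  by apply: (OpowM_to _ (hhP j jN) (Opow_linear_growth _ hT)); lra.
have o3 : Opow (fun t => \sum_(N.+1 <= j < n.+1)
    self_conv f j * (T t `^ (2^-1 - j%:R))%:C) a.
  apply: Opow_sum_nat => j jN; apply: (OpowM_to (add0r _)); first exact: Opow_cst.
  exact: Opow_weaken (tail j jN) (Opow_linear_growth _ hT).
apply: Opow_near (OpowD o1 (OpowD o2 o3)).
have Tpos := linear_growth_gt 0 hT; near=> t.
have T0 : 0 < T t by near: t.
rewrite /corrected_data enorm_gt0Z//.
rewrite [X in _ = _ - X - _](_ : _ = \sum_(1 <= j < N.+1) hh t j * (T t `^ (2^-1 - j%:R))%:C).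
  rewrite [\sum_(1 <= j < n.+1) self_conv f j * _](big_cat_nat _ (n := N.+1))//=.
  have -> : \sum_(1 <= j < N.+1) - ((hh t j - self_conv f j) * (T t `^ (2^-1 - j%:R))%:C)
     = \sum_(1 <= j < N.+1) self_conv f j * (T t `^ (2^-1 - j%:R))%:C
       - \sum_(1 <= j < N.+1) hh t j * (T t `^ (2^-1 - j%:R))%:C.
    by rewrite -sumrB; apply: eq_bigr => j _; ring.
  by ring.
apply: eq_bigr => j _; congr (_ * _).
by rewrite -(fmorphV (real_complex R)) -powRN opprB.
Unshelve. all: by end_near. Qed.

Variables (tau : R) (T : R -> nat -> R) (sigma : nat -> R).
Hypothesis T_lin : forall i, (1 <= i <= n)%N -> linear_growth (fun t => T t i) (sigma i).
Hypothesis sigma_inj : forall i j, (1 <= i <= n)%N -> (1 <= j <= n)%N ->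
  sigma i = sigma j -> i = j.
Hypothesis sync : forall i (t : R), (1 <= i <= n)%N -> 0 < t ->
  exists l : int, T t i * kappa = T t 1%N * kappa + 2 * l%:~R * pi.
Hypothesis tau_sin : sin (kappa * tau) != 0.

Let amplitude_sync i t (x : R) : (1 <= i <= n)%N -> 0 < t ->
  forall j, amplitude kappa f (T t i + x) j = amplitude kappa f (T t 1%N + x) j.
Proof.
move=> hi t0 j; have [l e] := sync hi t0; rewrite /amplitude !mulrN -!cis_conj.
have -> : cis ((T t i + x) * kappa) = cis ((T t 1%N + x) * kappa); last by [].
by rewrite mulrDl e addrAC cis_periodicz mulrDl.
Qed.

Let solve_error (x a : R) (N : nat) (hh : R -> nat -> R[i]) :
  (N <= n)%N -> - n%:R <= a ->
  (forall j, (1 <= j <= N)%N ->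
     Opow (fun t => hh t j - self_conv f j) (a + j%:R - 2^-1)) ->
  (forall j, (N < j <= n)%N -> 2^-1 - j%:R <= a) ->
  forall j, (1 <= j <= n)%N ->
    Opow (fun t => Q_solve n (fun i => T t i + x) (corrected_data u N (hh t)) xh j
      - amplitude kappa f (T t 1%N + x) j) (a + j%:R - 1).
Proof.
move=> Nn na hhP tail j jn.
have lin i : (1 <= i <= n)%N -> linear_growth (fun t => T t i + x) (sigma i).
  by move=> hi; apply: linear_growthD; exact: T_lin.
apply: (Q_solve_error lin sigma_inj (v := fun t => corrected_data u N (hh t))
  (A := fun j t => amplitude kappa f (T t 1%N + x) j)) => // i hi.
apply: Opow_near (corrected_data_error (lin i hi) Nn na hhP tail).
near=> t; have t0 : 0 < t by near: t; exact: near_pinfty_gt.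
by congr (_ - _); apply: eq_bigr => l _; rewrite amplitude_sync.
Unshelve. all: by end_near. Qed.

(** One pass of the procedure: an error O(t^(a + j - 1/2)) of the j-th
    correction coefficient becomes O(t^(a + j - 1)) for the retrieved f_j. *)
Lemma retrieval_error (a : R) (N : nat) (hh : R -> nat -> R[i]) :
  (N <= n)%N -> - n%:R <= a ->
  (forall j, (1 <= j <= N)%N ->
     Opow (fun t => hh t j - self_conv f j) (a + j%:R - 2^-1)) ->
  (forall j, (N < j <= n)%N -> 2^-1 - j%:R <= a) ->
  forall j (i : 'I_2), (1 <= j <= n)%N ->
    Opow (fun t => (invmx (phase_mx kappa tau (T t 1%N)) *m
        col2 (Q_solve n (T t) (corrected_data u N (hh t)) xh j)
             (Q_solve n (fun l => T t l + tau) (corrected_data u N (hh t)) xh j)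
      - col2 (f j) (f j)^*%C) i 0) (a + j%:R - 1).
Proof.
move=> Nn na hhP tail j i jn.
have [Eu Einv] := @phase_mx_inv R kappa tau (fun t => T t 1%N) tau_sin.
have e1 : Opow (fun t => Q_solve n (T t) (corrected_data u N (hh t)) xh j
    - amplitude kappa f (T t 1%N) j) (a + j%:R - 1).
  apply: Opow_near (solve_error 0 Nn na hhP tail jn); near=> t.
  have fE : (fun l => T t l + 0) = T t by apply/funext => l; exact: addr0.
  exact: (f_equal2 (fun TT z => Q_solve n TT (corrected_data u N (hh t)) xh j
    - amplitude kappa f z j) fE (addr0 (T t 1%N))).
have e2 := solve_error tau Nn na hhP tail jn.
apply: Opow_near (OpowD (OpowM_to (add0r _) (Einv i ord0) e1)
                        (OpowM_to (add0r _) (Einv i (lift ord0 ord0)) e2)).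
near=> t; set E := phase_mx _ _ _; have EuT : E \in unitmx by exact: Eu.
have -> : col2 (f j) (f j)^*%C = invmx E *m
    col2 (amplitude kappa f (T t 1%N) j) (amplitude kappa f (T t 1%N + tau) j).
  rewrite -[LHS](mulKmx EuT); congr (_ *m _); apply/colP => l.
  rewrite !mxE big_ord_recl big_ord1 !mxE /amplitude.
  by case: l => -[|[|//]] hl.
rewrite -mulmxBr [RHS]mxE big_ord_recl big_ord1 !mxE /=.
by [].
Unshelve. all: by end_near. Qed.

End Retrieval.

(** kappa = k (1 - xh.d) is positive by the strict Cauchy-Schwarz inequality. *)
Lemma phase_rate_gt0 {R : realType} (k : R) (xh d : 'rV[R]_2) :
  0 < k -> enorm xh = 1 -> enorm d = 1 -> xh <> d -> 0 < phase_rate k xh d.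
Proof.
move=> k0 x1 d1 xd; rewrite /phase_rate pmulr_rgt0// subr_gt0.
have hx : dot xh xh = 1 by rewrite -sqr_enorm x1 expr1n.
have hd : dot d d = 1 by rewrite -sqr_enorm d1 expr1n.
have e : dot (xh - d) (xh - d) = 2 - 2 * dot xh d.
  by move: hx hd; rewrite !dotE !mxE => hx hd; lra.
have : 0 < dot (xh - d) (xh - d).
  rewrite lt_neqAle dotxx_ge0 andbT eq_sym -sqr_enorm sqrf_eq0; apply/negP => /eqP z.
  apply: xd; apply/eqP; rewrite -subr_eq0 -normr_eq0 eq_le normr_ge0 andbT.
  by rewrite -z norm_le_enorm.
by rewrite e; lra.
Qed.

Theorem theorem4p10 (R : realType) (k alpha : R) (D : set 'rV[R]_2)
  (nu : 'rV[R]_2 -> 'rV[R]_2) (d : 'rV[R]_2) (B : boundary_condition)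
  (us : 'rV[R]_2 -> R[i]) (f : nat -> 'rV[R]_2 -> R[i])
  (n : nat) (sigma : nat -> R) (xh : 'rV[R]_2) (tau : R)
  (c1 : R) (c : nat -> R -> R) (fprev : nat -> R -> R[i])
  (* the scattering problem *)
  (k_gt0 : 0 < k) (alpha_gt0 : 0 < alpha) (alpha_le1 : alpha <= 1)
  (D_dom : plane_domain D) (D_bnd : bounded_set D)
  (D_compl : complement_of_unbounded_domain D)
  (D_bdry : C3_holder_boundary alpha D)
  (nuP : unit_exterior_normal D nu)
  (d_unit : enorm d = 1)
  (usP : biharmonic_scattering k d D nu B us)
  (fP : atkinson_expansion k (helmholtz_part k us) f)
  (* the measurement radii *)
  (n_gt0 : (0 < n)%N)
  (sigma_gt0 : forall j, (1 <= j <= n)%N -> 0 < sigma j)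
  (sigma_inj : forall i j, (1 <= i <= n)%N -> (1 <= j <= n)%N ->
     sigma i = sigma j -> i = j)
  (xh_unit : enorm xh = 1) (xh_neq : xh <> d)
  (tauP : forall l : int, tau <> l%:~R * pi / phase_rate k xh d)
  (c1_ge0 : 0 <= c1)
  (c1P : forall t : R, 0 < t -> c 1%N t = c1)
  (cP : forall (j : nat) (t : R), (2 <= j <= n)%N -> 0 < t ->
     0 <= c j t < 2 * pi / phase_rate k xh d)
  (c_sync : forall (j : nat) (t : R), (2 <= j <= n)%N -> 0 < t ->
     exists l : int, (sigma j * t + c j t) - (sigma 1%N * t + c 1%N t)
       = 2 * l%:~R * pi / phase_rate k xh d)
  (* the approximations of order n - 1 *)
  (fprevP : forall l : nat, (1 <= l < n)%N ->
     bigO_pinfty (fun t : R => fprev l t - f l xh) (fun t : R => t ^- (n - l))) :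
  let u := total_field k d us in
  let T (t : R) (j : nat) : R := sigma j * t + c j t in
  let T' (t : R) (j : nat) : R := T t j + tau in
  let E (t : R) := phase_mx (phase_rate k xh d) tau (T t 1%N) in
  let h (t : R) := self_conv (fun l => fprev l t) in
  let v (t : R) := corrected_data u (n - 1) (h t) in
  let F (t : R) := Q_solve n (T t) (v t) xh in
  let F' (t : R) := Q_solve n (T' t) (v t) xh in
  let ftilde (t : R) (j : nat) : R[i] :=
    (invmx (E t) *m col2 (F t j) (F' t j)) 0 0 in
  let htilde (t : R) := self_conv (ftilde t) in
  let w (t : R) := corrected_data u n (htilde t) in
  let G (t : R) := Q_solve n (T t) (w t) xh in
  let G' (t : R) := Q_solve n (T' t) (w t) xh in
  forall (j : nat) (i : 'I_2), (1 <= j <= n)%N ->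
    bigO_pinfty
      (fun t : R => (col2 (f j xh) (f j xh)^*%C
                     - invmx (E t) *m col2 (G t j) (G' t j)) i 0)
      (fun t : R => t ^- (n.+1 - j)).

Proof.
set kappa := phase_rate k xh d => u T T' E h v F F' ftilde htilde w G G' j i jn.
have kap0 : 0 < kappa by exact: phase_rate_gt0.
have [us4 usE _ _ usR] := usP.
pose fx l := f l xh.
have dataP := data_expansion d
  (scattered_field_expansion k_gt0 d_unit D_bnd us4 usE usR fP n_gt0 xh_unit).
have Tlin l : (1 <= l <= n)%N -> linear_growth (fun t => T t l) (sigma l).
  move=> ln; split; first exact: sigma_gt0.
  exists (Num.max c1 (2 * pi / kappa)); near=> t.
  have t0 : 0 < t by near: t; exact: near_pinfty_gt.
  rewrite /T addrAC subrr add0r le_max.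
  have [l1|l2] := leqP l 1.
    have -> : l = 1%N by apply/eqP; rewrite eqn_leq l1; case/andP: ln.
    by rewrite c1P// ger0_norm// lexx.
  have /andP[c0 cl] : 0 <= c l t < 2 * pi / kappa.
    by apply: cP => //; rewrite l2; case/andP: ln.
  by rewrite ger0_norm// (ltW cl) orbT.
have sync l (t : R) : (1 <= l <= n)%N -> 0 < t ->
    exists z : int, T t l * kappa = T t 1%N * kappa + 2 * z%:~R * pi.
  move=> ln t0; have [l1|l2] := leqP l 1.
    exists 0; have -> : l = 1%N by apply/eqP; rewrite eqn_leq l1; case/andP: ln.
    by rewrite mulr0 mul0r addr0.
  have [|z ze] := @c_sync l t _ t0; first by rewrite l2; case/andP: ln.
  have {}ze : T t l - T t 1%N = 2 * z%:~R * pi / kappa := ze.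
  exists z; move: (T t l) (T t 1%N) ze => p q pq.
  by rewrite -[p](subrK q) pq mulrDl divfK ?gt_eqF// addrC.
have tau_sin : sin (kappa * tau) != 0.
  apply/eqP => /sin_eq0_int[l le]; apply: (tauP l).
  by rewrite -le mulrC mulKf// gt_eqF.
have colB (A C : 'cV[R[i]]_2) l : (A - C) l 0 = A l 0 - C l 0 by rewrite !mxE.
pose pass := @retrieval_error R u xh fx n kappa xh_unit dataP tau T sigma Tlin sigma_inj sync tau_sin.
(* first pass: the correction coefficients of order n - 1 have error t^(j-n) *)
have hE l : (1 <= l <= n - 1)%N ->
    Opow (fun t => h t l - self_conv fx l) (2^-1 - n%:R + l%:R - 2^-1).
  move=> ln; rewrite (_ : 2^-1 - n%:R + l%:R - 2^-1 = l%:R - n%:R); last by ring.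
  apply: (@self_conv_error R (fun t l => fprev l t) fx n%:R (n - 1)) => //.
    by rewrite ler_nat leq_subr.
  move=> m /andP[m1 mn]; have mn' : (m < n)%N by rewrite (leq_ltn_trans mn)// subn1 prednK.
  have /bigO_pinfty_Opow : bigO_pinfty (fun t => fprev m t - f m xh) (fun t => t ^- (n - m)).
    by apply: fprevP; rewrite m1.
  by rewrite natrB ?(ltnW mn')// opprB.
have ftE l : (1 <= l <= n)%N -> Opow (fun t => ftilde t l - fx l) (l%:R - (n%:R + 2^-1)).
  move=> ln; rewrite (_ : l%:R - (n%:R + 2^-1) = 2^-1 - n%:R + l%:R - 1 :> R); last by lra.
  have a1 : - n%:R <= 2^-1 - n%:R :> R by lra.
  have tail m : (n - 1 < m <= n)%N -> 2^-1 - m%:R <= 2^-1 - n%:R :> R.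
    by move=> /andP[m1 _]; rewrite lerD2l lerN2 ler_nat; rewrite subn1 prednK in m1.
  apply: Opow_near (pass _ _ _ (leq_subr 1 n) a1 hE tail l 0 ln); near=> t.
  by rewrite colB; congr (_ - _); rewrite mxE.
(* second pass: the improved coefficients have error t^(j-n-1/2) *)
have htE l : (1 <= l <= n)%N ->
    Opow (fun t => htilde t l - self_conv fx l) (- n%:R + l%:R - 2^-1).
  move=> ln; rewrite (_ : - n%:R + l%:R - 2^-1 = l%:R - (n%:R + 2^-1)); last by ring.
  by apply: (@self_conv_error R ftilde fx (n%:R + 2^-1) n) => //; rewrite lerDl invr_ge0.
have tail0 m : (n < m <= n)%N -> 2^-1 - m%:R <= - n%:R :> R.
  by case/andP => nm mn; have := leq_trans nm mn; rewrite ltnn.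
have final := pass _ _ _ (leqnn n) (lexx _) htE tail0 j i jn.
apply/bigO_pinfty_Opow.
have /andP[_ jn'] := jn.
rewrite natrB ?(leqW jn')// (_ : - (n.+1%:R - j%:R) = - n%:R + j%:R - 1 :> R); last first.
  by rewrite -[n.+1%:R]natr1; ring.
apply: Opow_near (OpowN final); near=> t.
by rewrite !colB opprB.
Unshelve. all: by end_near. Qed.
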